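(* In the setting below, for every nonempty $A\subseteq[n]$: \[ \Pr_{\omega\sim\mathrm{Walk}(G,l)}\big(|\mathrm{estimate}(\tau_2(\omega,q(\omega)),q(\omega))-|A||>\varepsilon|A|\big)\le\delta. \]
   Context: $[N]:=\{0,\dots,N-1\}$. Fix integers $n\ge1$, reals $0<\varepsilon<1$ and $(\ln n)^{-1}\le\delta<1$. Let $l:=\lceil4\ln(2\delta^{-1})\rceil$, $b:=2^{\lceil\log_2(9\cdot2^{23}\varepsilon^{-2})\rceil}$, $k:=\lceil\tfrac{15}2\ln b+16\rceil$, $\lambda:=\min(\tfrac1{16},\exp(-l(\ln l)^3))$. Hash families: for $d\ge1$, identify $[2^d]$ with $\mathrm{GF}(2^d)$ via binary representation. For $k'\ge1$, $N\le2^d$, $c\le d$, $\mathcal H_{k'}([N],[2^c])$ is the uniform distribution over tuples $(a_0,\dots,a_{k'-1})\in\mathrm{GF}(2^d)^{k'}$, each giving $x\mapsto(\sum_ia_ix^i)\bmod2^c$ on $[N]$; $\mathcal G_{k'}([N])$ is uniform over the same tuples giving $x\mapsto\mathrm{tz}(\sum_ia_ix^i)$, $\mathrm{tz}(y)$ = number of trailing zeros of the $d$-bit representation of $y$ ($\mathrm{tz}(0)=d$); $d$ a fixed integer with $2^d\ge N$, $d\ge c$. $\Psi:=\mathcal G_2([n])\times\mathcal H_2([n],[2^5b^2])\times\mathcal H_k([2^5b^2],[b])$, $\psi=(f,g,h)$. Graphs: finite undirected multigraphs (loops allowed) with adjacency matrix $A=(a_{uv})$ counting edges; $d$-regular if symmetric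 with row sums $d$; a $\lambda$-expander if $d$-regular and the second largest absolute eigenvalue of $A$ is $\le d\lambda$. $\mathrm{Walk}(G,l)$: $w_0$ uniform on the vertex set, $w_{i+1}=u$ with probability $a_{w_iu}/d$. Let $G$ be a $\lambda$-expander with vertex set $\Psi$; a walk $\omega$ has vertices $\omega_0,\dots,\omega_{l-1}\in\Psi$. For fixed nonempty $A\subseteq[n]$: $\tau_0(\psi)[j]:=\max(\{f(a):a\in A,h(g(a))=j\}\cup\{-1\})$; $\tau_1(\psi,q)[j]:=\max(\tau_0(\psi)[j]-q,-1)$; $\tau_2(\omega,q)[i,j]:=\tau_1(\omega_i,q)[j]$; $q(\omega):=\min\{q\in\mathbb Z_{\ge0}:\sum_{i\in[l],j\in[b]}\lfloor\log_2(\tau_2(\omega,q)[i,j]+2)\rfloor\le33\,b\,l\}$. For a table $B:[l]\times[b]\to\mathbb Z$ and $q\ge0$, $\mathrm{estimate}(B,q)$: for each $i\in[l]$ let $s_i:=\max(0,\max_j(B[i,j]+q)-\log_2b+9)$, $p_i:=|\{j\in[b]:B[i,j]+q\ge s_i\}|$, $Y_i:=2^{s_i}\ln(1-p_i/b)/\ln(1-1/b)$ (with $Y_i:=+\infty$ if $p_i=b$); return the element at position $\lfloor l/2\rfloor$ (0-indexed) of the sorted list $Y_0,\dots,Y_{l-1}$. *)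

(* Defs.v *)
From HB Require Import structures.
From mathcomp Require Import all_boot all_order all_algebra.
From mathcomp Require Import all_classical all_reals all_analysis.
From mathcomp Require Import zify.

Set Implicit Arguments.
Unset Strict Implicit.
Unset Printing Implicit Defensive.

Import Order.TTheory GRing.Theory Num.Theory.
Local Open Scope ring_scope.

Definition l_par {R : realType} (delta : R) : nat :=
  `|Num.ceil (4 * ln (2 / delta))|%N.

Definition lb_par {R : realType} (eps : R) : nat :=
  `|Num.ceil (ln (9 * 2 ^+ 23 * eps ^-2) / ln 2)|%N.

Definition b_par {R : realType} (eps : R) : nat := (2 ^ lb_par eps)%N.

Definition k_par {R : realType} (eps : R) : nat :=
  `|Num.ceil (15 / 2 * ln ((b_par eps)%:R : R) + 16)|%N.

Definition lambda_par {R : realType} (delta : R) : R :=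
  Num.min (1 / 16) (expR (- ((l_par delta)%:R * (ln ((l_par delta)%:R : R)) ^+ 3))).

(* GF(2^d), identified with [2^d] via binary representation.             *)
(* GF(2^d) = F_2[X] / (P) for an irreducible P of degree d; the element   *)
(* x in [2^d] is the residue of the polynomial whose i-th coefficient is  *)
(* the i-th bit of x.                                                     *)

Definition bits_poly (d x : nat) : {poly 'F_2} :=
  \poly_(i < d) ((odd (x %/ 2 ^ i))%:R).

Definition poly_nat (d : nat) (p : {poly 'F_2}) : nat :=
  \sum_(i < d) (((p`_i != 0)%R : bool) * 2 ^ i)%N.

Definition hashval (d : nat) (P : {poly 'F_2}) (k : nat)
    (a : {ffun 'I_k -> 'I_(2 ^ d)}) (x : nat) : nat :=
  poly_nat d ((\sum_(i < k) bits_poly d (a i) * bits_poly d x ^+ i) %% P).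

(* number of trailing zeros of the d-bit representation, tz(0) = d *)
Definition tz (d y : nat) : nat := if y == 0%N then d else logn 2 y.

(* Psi = G_2([n]) x H_2([n],[2^5 b^2]) x H_k([2^5 b^2],[b]) (coefficient tuples) *)
Notation Psi df dg dh k :=
  (({ffun 'I_2 -> 'I_(2 ^ df)} * {ffun 'I_2 -> 'I_(2 ^ dg)})
    * {ffun 'I_k -> 'I_(2 ^ dh)})%type.

Section Hashes.
Variables (df dg dh k lb : nat) (Pf Pg Ph : {poly 'F_2}).

Definition fH (psi : Psi df dg dh k) (x : nat) : nat :=
  tz df (hashval Pf psi.1.1 x).
Definition gH (psi : Psi df dg dh k) (x : nat) : nat :=
  (hashval Pg psi.1.2 x %% (2 ^ 5 * (2 ^ lb) ^ 2))%N.
Definition hH (psi : Psi df dg dh k) (x : nat) : nat :=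
  (hashval Ph psi.2 x %% 2 ^ lb)%N.

Definition tau0 (n : nat) (A : {set 'I_n}) (psi : Psi df dg dh k) (j : nat) : int :=
  \big[Num.max/(-1 : int)]_(a in A | hH psi (gH psi a) == j) ((fH psi a)%:Z).

End Hashes.

Definition tau1v (t : int) (q : nat) : int := Num.max (t - q%:Z) (-1).

Definition qP (L bb : nat) (T : 'I_L -> 'I_bb -> int) (q : nat) : bool :=
  (\sum_(i < L) \sum_(j < bb) trunc_log 2 (absz (tau1v (T i j) q + 2)%R)
     <= 33 * bb * L)%N.

Lemma qP_ex (L bb : nat) (T : 'I_L -> 'I_bb -> int) : exists q, qP T q.
Proof.
exists (\max_(i < L) \max_(j < bb) `|T i j|%N).+1.
rewrite /qP big1 // => i _; rewrite big1 // => j _.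
have H1 : (`|T i j| <= \max_(i < L) \max_(j < bb) `|T i j|)%N.
  apply: (leq_trans _ (leq_bigmax i)).
  exact: (leq_bigmax (F := fun j => `|T i j|%N) j).
rewrite /tau1v.
set M := (\max_(i0 < L) \max_(j0 < bb) `|T i0 j0|)%N in H1 *.
have -> : Num.max (T i j - M.+1%:Z) (-1) = -1.
  apply/max_idPr.
  have H2 := lez_abs (T i j).
  have H3 : ((`|T i j|%N : int) <= (M : int))%R by rewrite lez_nat.
  lia.
by [].
Qed.

Definition qmin (L bb : nat) (T : 'I_L -> 'I_bb -> int) : nat := ex_minn (qP_ex T).

Definition estimate {R : realType} (L lb : nat) (B : 'I_L -> 'I_(2 ^ lb) -> int)
    (q : nat) : \bar R :=
  let s i := Num.max 0
      (let xs := [seq B i j + q%:Z | j <- enum 'I_(2 ^ lb)] in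
       (\big[Num.max/head 0 xs]_(x <- xs) x) - lb%:Z + 9) in
  let p i := #|[set j : 'I_(2 ^ lb) | s i <= B i j + q%:Z]| in
  let Y i : \bar R :=
    if p i == (2 ^ lb)%N then +oo%E
    else ((2 : R) ^ s i * ln (1 - (p i)%:R / (2 ^ lb)%:R) / ln (1 - 1 / (2 ^ lb)%:R))%:E in
  nth 0%E (sort (fun x y => (x <= y)%E) [seq Y i | i <- enum 'I_L]) (L %/ 2).

(* adjacency matrix (entries a_uv counting edges) as a real matrix, vertices enumerated *)
Definition adj_mx {R : realType} {V : finType} (a : V -> V -> nat) : 'M[R]_#|V| :=
  \matrix_(i, j) (a (enum_val i) (enum_val j))%:R.

Definition regular {V : finType} (a : V -> V -> nat) (d : nat) : Prop :=
  (forall u v, a u v = a v u) /\ (forall u, (\sum_(v : V) a u v)%N = d).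

(* d-regular and the second largest absolute eigenvalue (with multiplicity) of A is <= d lambda *)
Definition expander {R : realType} {V : finType} (a : V -> V -> nat) (d : nat) (lam : R) : Prop :=
  regular a d /\
  exists s : seq R,
    char_poly (adj_mx (R := R) a) = \prod_(z <- s) ('X - z%:P) /\
    nth 0 (sort (fun x y => y <= x) [seq `|z| | z <- s]) 1 <= d%:R * lam.

Definition walk_weight {R : realType} {V : finType} (a : V -> V -> nat) (d L : nat)
    (w : L.-tuple V) : R :=
  #|V|%:R^-1 * \prod_(uv <- zip w (behead w)) ((a uv.1 uv.2)%:R / d%:R).

Definition walk_prob {R : realType} {V : finType} (a : V -> V -> nat) (d L : nat)
    (E : pred (L.-tuple V)) : R :=
  \sum_(w : L.-tuple V | E w) walk_weight (R := R) a d w.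

Section Walks.
Variables (df dg dh k lb : nat) (Pf Pg Ph : {poly 'F_2}) (n : nat) (A : {set 'I_n}).
Variable L : nat.

Definition tau0_tab (w : L.-tuple (Psi df dg dh k)) : 'I_L -> 'I_(2 ^ lb) -> int :=
  fun i j => tau0 lb Pf Pg Ph A (tnth w i) j.

Definition tau2 (w : L.-tuple (Psi df dg dh k)) (q : nat) : 'I_L -> 'I_(2 ^ lb) -> int :=
  fun i j => tau1v (tau0_tab w i j) q.

Definition q_of (w : L.-tuple (Psi df dg dh k)) : nat := qmin (tau0_tab w).

End Walks.

(* Main.v *)
(* Call a seed psi = (f, g, h) good if (1) the largest value of f on A estimates
   log2 |A| up to a constant, so that the cutoff s keeps between 2^-16 b and b/2
   elements of A in expectation, (2) the number of elements kept is close to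
   |A| / 2^s, (3) g is injective on them, and (4) the number of bins of h that
   they occupy is close to its expectation under full independence.  Pairwise
   independence gives (1)-(3) by Chebyshev and union bounds.  For (4) the
   probability that one or two given bins stay empty is computed, up to a
   negligible error, by inclusion-exclusion truncated at k terms, which only
   needs k-wise independence.  A seed is bad with probability at most 1/16, and
   a good row estimates |A| up to the factor 1 +- eps as soon as the
   subsampling level q is at most the least q0 with |A| <= 2^q0 b.

   Along the walk, E[prod W(w_i)] <= (E W + lambda max W)^l for every W >= 0.
   With W = 16 on bad seeds and 1 elsewhere, half of the rows are bad (which is
   necessary for the median to be wrong) with probability at most (3/4)^l.  The
   storage of one row at level q0 has a doubly exponential tail, so W = 2^storage,
   capped where 1/lambda takes over, bounds the probability that q exceeds q0. *)
Require Import Defs.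
From HB Require Import structures.
From mathcomp Require Import all_boot all_order all_algebra all_field.
From mathcomp Require Import complex.
From mathcomp Require Import all_classical all_reals all_analysis.
From mathcomp Require Import zify ring lra.
Import Order.TTheory GRing.Theory Num.Theory.
Local Open Scope ring_scope.

Set Implicit Arguments.
Unset Strict Implicit.
Unset Printing Implicit Defensive.

(** * Averages over finite types and polynomial hashing *)


(** Two quantities are chosen by the randomness itself. The level [q] depends on the whole walk.
    Adding [q] back to a stored value restores it down to the floor [q - 1], so every comparison at
    a threshold [s >= q] comes out as on the uncompressed row. Accuracy of a good row therefore
    holds for all [q] up to its cutoff at once, and as [q] is minimal, only the storage at the fixed
    level [q0] has to be controlled. The cutoff depends on [f], so one Chebyshev bound is not
    enough; a union over all admissible cutoffs costs a geometric sum and is where [9 * 2 ^+ 23] is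
    used up.

    The four ways to be bad get [2 ^- 6] each. Both terms of [lambda_par] are used: [1 / 16] keeps
    [lam * max W] at most 1 for the weight 16, and the exponential term gives [lam * 2 ^+ l <= 1]
    for the storage weight. Everything aims at [2 * (3 / 4) ^+ l <= delta], which is how
    [l >= 4 ln (2 / delta)] enters. *)

Definition mean {R : realType} {T : finType} (f : T -> R) : R :=
  (\sum_x f x) / #|T|%:R.

Section Mean.
Context {R : realType} {T : finType}.
Implicit Types f g : T -> R.

Lemma eq_mean f g : f =1 g -> mean f = mean g.
Proof. by move=> fg; rewrite /mean (eq_bigr g). Qed.

Lemma mean_ge0 f : (forall x, 0 <= f x) -> 0 <= mean f.
Proof. by move=> f0; rewrite divr_ge0 ?ler0n ?sumr_ge0. Qed.

Lemma ler_mean f g : (forall x, f x <= g x) -> mean f <= mean g.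
Proof. by move=> fg; rewrite ler_wpM2r ?invr_ge0 ?ler0n// ler_sum. Qed.

Lemma meanD f g : mean (fun x => f x + g x) = mean f + mean g.
Proof. by rewrite /mean big_split mulrDl. Qed.

Lemma meanZ c f : mean (fun x => c * f x) = c * mean f.
Proof. by rewrite /mean -mulr_sumr mulrA. Qed.

Lemma mean_sum I (r : seq I) (P : pred I) (F : I -> T -> R) :
  mean (fun x => \sum_(i <- r | P i) F i x) = \sum_(i <- r | P i) mean (F i).
Proof. by rewrite /mean exchange_big mulr_suml. Qed.

Lemma mean_cst (c : R) : (0 < #|T|)%N -> mean (fun _ : T => c) = c.
Proof.
move=> T0; rewrite /mean sumr_const -[c *+ _]mulr_natr -mulrA divff ?mulr1 //.
by rewrite pnatr_eq0 -lt0n.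
Qed.

Lemma markov_mean (E : pred T) f (c : R) : 0 < c -> (forall x, 0 <= f x) ->
  (forall x, E x -> c <= f x) -> mean (fun x => (E x)%:R) <= mean f / c.
Proof.
move=> c0 f0 Ef; rewrite mulrC -meanZ; apply: ler_mean => x.
rewrite mulrC; case: (boolP (E x)) => [/Ef|_]; last by rewrite divr_ge0 // ltW.
by rewrite ler_pdivlMr // mul1r.
Qed.

End Mean.

Lemma mean_pair {R : realType} {S T : finType} (f : S * T -> R) :
  mean f = mean (fun x => mean (fun y => f (x, y))).
Proof.
rewrite /mean card_prod natrM invfM -mulr_suml mulrAC -!mulrA; congr (_ * _).
by rewrite pair_bigA; apply: eq_bigr => -[].
Qed.

Lemma mean_bij {R : realType} {S T : finType} (h : S -> T) (f : T -> R) :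
  bijective h -> mean (fun x => f (h x)) = mean f.
Proof.
move=> bh; rewrite /mean (bij_eq_card bh); congr (_ / _).
by rewrite [RHS](reindex h) //=; exact: onW_bij.
Qed.

Lemma mean_prod_ffun {R : realType} {S T : finType} (G : S -> T -> R) :
  mean (fun y : {ffun S -> T} => \prod_j G j (y j)) = \prod_j mean (G j).
Proof.
rewrite /mean -bigA_distr_bigA card_ffun natrX.
by rewrite big_split /= prodr_const exprVn.
Qed.

Section PolynomialHash.
Variable F : finFieldType.

(* The values at m distinct points together with the coefficients of degree *)
(* at least m determine a polynomial, so this map is a bijection.           *)
Lemma eval_high_coef_bij m r (X : 'I_m -> F) : injective X ->
  bijective (fun a : {ffun 'I_(m + r) -> F} =>
    ([ffun j => \sum_i a i * X j ^+ i] : {ffun 'I_m -> F},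
     [ffun i => a (rshift m i)] : {ffun 'I_r -> F})).
Proof.
move=> injX; apply: inj_card_bij; last first.
  by rewrite card_prod !card_ffun !card_ord expnD.
move=> a a' [/ffunP ea /ffunP eh].
pose p := \poly_(i < m) (if insub i is Some j then a (lshift r j) - a' (lshift r j) else 0).
have p0 : p = 0.
  apply/eqP; apply: contraT => pN0.
  have /(max_poly_roots pN0) : all (root p) (codom X).
    apply/allP => _ /codomP[j ->]; apply/eqP.
    have := ea j; rewrite !ffunE !big_split_ord /= => /eqP.
    have -> : \sum_(i < r) a (rshift m i) * X j ^+ (m + i) =
              \sum_(i < r) a' (rshift m i) * X j ^+ (m + i).
      by apply: eq_bigr => i _; have := eh i; rewrite !ffunE => ->.
    rewrite -subr_eq0 opprD addrACA subrr addr0 -sumrB => /eqP e.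
    rewrite horner_poly -[RHS]e; apply: eq_bigr => i _.
    by rewrite valK mulrBl.
  rewrite (_ : uniq (codom X)); last exact/injectiveP.
  move=> /(_ isT); rewrite size_codom card_ord ltnNge => /negP[].
  exact: size_poly.
apply/ffunP => i; case: (split_ordP i) => j ->; last first.
  by have := eh j; rewrite !ffunE.
have /(congr1 (fun q : {poly F} => q`_j)) := p0.
by rewrite coef_poly ltn_ord valK coef0 => /eqP; rewrite subr_eq0 => /eqP.
Qed.

(** Independence of at most [k] values: after the change of variables the values are free
    coordinates, and the remaining high coefficients average out. *)
Lemma mean_prod_poly_eval {R : realType} m k (X : 'I_m -> F) (G : 'I_m -> F -> R) :
  injective X -> (m <= k)%N ->
  mean (fun a : {ffun 'I_k -> F} => \prod_j G j (\sum_i a i * X j ^+ i)) =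
  \prod_j mean (G j).
Proof.
move=> injX lemk; rewrite -(subnKC lemk); move: (k - m)%N => r.
have := mean_bij (fun yz : {ffun 'I_m -> F} * {ffun 'I_r -> F} =>
    \prod_j G j (yz.1 j)) (eval_high_coef_bij r injX).
rewrite mean_pair /=.
under [X in _ = X -> _]eq_mean => y.
  rewrite mean_cst ?over //; rewrite card_ffun expn_gt0.
  by rewrite (ltnW (card_finNzRing_gt1 F)).
rewrite mean_prod_ffun => <-; apply: eq_mean => a; apply: eq_bigr => j _.
by rewrite ffunE.
Qed.

End PolynomialHash.

Section BinaryField.
Variables (d : nat) (P : {poly 'F_2}).
Hypotheses (irrP : irreducible_poly P) (sizeP : size P = d.+1).

Lemma F2_neq0 (c : 'F_2) : c = ((c != 0) : nat)%:R.
Proof. by case: c => -[|[|[]]] //= i; apply/val_inj. Qed.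

Lemma irreducible_F2_monic : monic_irreducible_poly P.
Proof.
split=> //; rewrite monicE [lead_coef P]F2_neq0 lead_coef_eq0.
by rewrite -size_poly_eq0 sizeP.
Qed.

Local Notation GF := {poly %/ P with irreducible_F2_monic}.

Definition gf_of (x : nat) : GF := in_qpoly P (bits_poly d x).

Lemma size_bits_poly x : (size (bits_poly d x) <= d)%N.
Proof. exact: size_poly. Qed.

Lemma val_gf_of x : val (gf_of x) = bits_poly d x.
Proof.
rewrite /gf_of /= /in_qpoly /=.
rewrite (mk_monicE irreducible_F2_monic).
rewrite Pdiv.CommonRing.rmodp_small // sizeP ltnS; exact: size_bits_poly.
Qed.

Lemma sum_bits e x : \sum_(i < e) (odd (x %/ 2 ^ i) * 2 ^ i)%N = (x %% 2 ^ e)%N.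
Proof.
elim: e => [|e IH]; first by rewrite big_ord0 modn1.
rewrite big_ord_recr /= IH expnSr.
set y := (x %/ 2 ^ e)%N; have ltr : (x %% 2 ^ e < 2 ^ e)%N by rewrite ltn_mod expn_gt0.
have def_x : x = (y./2 * (2 ^ e * 2) + (odd y * 2 ^ e + x %% 2 ^ e))%N.
  have := odd_double_half y; rewrite {1}(divn_eq x (2 ^ e)) -/y -muln2 => {1}<-.
  by rewrite mulnDl addnA; congr (_ + _)%N; rewrite addnC -mulnA [(2 * _)%N]mulnC.
rewrite -[LHS]/(x %% 2 ^ e + odd y * 2 ^ e)%N addnC [in RHS]def_x modnMDl; apply/esym/modn_small.
by case: (odd y); rewrite ?mul0n ?mul1n; lia.
Qed.

Lemma poly_nat_bits x : (x < 2 ^ d)%N -> poly_nat d (bits_poly d x) = x.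
Proof.
move=> xd; rewrite /poly_nat -[RHS](modn_small xd) -sum_bits.
apply: eq_bigr => i _; rewrite coef_poly ltn_ord; congr (_ * _)%N.
by case: (odd _); rewrite ?eqxx ?oner_eq0.
Qed.

Lemma gf_of_bij : bijective (fun x : 'I_(2 ^ d) => gf_of x).
Proof.
apply: inj_card_bij.
  move=> x y /(congr1 val); rewrite !val_gf_of => /(congr1 (poly_nat d)).
  by rewrite !poly_nat_bits // => /val_inj.
by rewrite card_qfpoly !card_ord sizeP.
Qed.

Lemma hashval_gf k (a : {ffun 'I_k -> 'I_(2 ^ d)}) x :
  hashval P a x = poly_nat d (val (\sum_i gf_of (a i) * gf_of x ^+ i : GF)).
Proof.
rewrite /hashval; congr poly_nat.
have -> : (\sum_(i < k) gf_of (a i) * gf_of x ^+ i : GF) =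
   in_qpoly P (\sum_(i < k) bits_poly d (a i) * bits_poly d x ^+ i).
  rewrite (raddf_sum (in_qpoly P)) /=; apply: eq_bigr => i _.
  by rewrite in_qpolyM (rmorphXn (in_qpoly P)).
rewrite /= (mk_monicE irreducible_F2_monic).
by rewrite Pdiv.IdomainMonic.modpE // irreducible_F2_monic.2.
Qed.

(** The only source of independence for [f], [g] and [h]. The bound [N <= 2 ^ d] makes distinct
    inputs distinct field elements; reading bits back turns uniform field elements into uniform
    integers. *)
Lemma mean_prod_hashval {R : realType} N k (S : {set 'I_N}) (G : 'I_N -> nat -> R) :
  (N <= 2 ^ d)%N -> (#|S| <= k)%N ->
  mean (fun a : {ffun 'I_k -> 'I_(2 ^ d)} => \prod_(x in S) G x (hashval P a x)) =
  \prod_(x in S) mean (fun y : 'I_(2 ^ d) => G x y).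
Proof.
move=> Nd Sk.
have gfK (y : 'I_(2 ^ d)) : poly_nat d (val (gf_of y)) = y.
  by rewrite val_gf_of poly_nat_bits.
have injX : injective (fun j : 'I_#|S| => gf_of (enum_val j)).
  move=> i j /(congr1 (fun z => poly_nat d (val z))).
  rewrite !val_gf_of !poly_nat_bits ?(leq_trans (ltn_ord _)) //.
  by move=> /val_inj/enum_val_inj.
have [g gK Kg] := gf_of_bij.
have bij_map : bijective (fun a : {ffun 'I_k -> 'I_(2 ^ d)} =>
    [ffun i => gf_of (a i)] : {ffun 'I_k -> GF}).
  exists (fun c : {ffun 'I_k -> GF} => [ffun i => g (c i)]) => c; apply/ffunP => i;
    by rewrite !ffunE /= ?gK ?Kg.
have := mean_prod_poly_eval (fun j (y : GF) => G (enum_val j) (poly_nat d (val y))) injX Sk.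
rewrite -(mean_bij _ bij_map) => e.
rewrite [RHS]big_enum_val /=.
under [RHS]eq_bigr => j _.
  rewrite -[mean _](_ : mean (fun y : GF => G (enum_val j) (poly_nat d (val y))) = _).
    over.
  rewrite -(mean_bij _ gf_of_bij); apply: eq_mean => y; by rewrite gfK.
rewrite -e; apply: eq_mean => a; rewrite big_enum_val; apply: eq_bigr => j _.
by rewrite hashval_gf; under [in RHS]eq_bigr do rewrite ffunE.
Qed.

End BinaryField.

Lemma mean_modn {R : realType} c d (G : nat -> R) : (c <= d)%N ->
  mean (fun y : 'I_(2 ^ d) => G (y %% 2 ^ c)%N) = mean (fun z : 'I_(2 ^ c) => G z).
Proof.
move=> cd; rewrite /mean !card_ord -(subnK cd) expnD.
have H q : \sum_(y < q * 2 ^ c) G (y %% 2 ^ c)%N = q%:R * \sum_(z < 2 ^ c) G z.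
  elim: q => [|q IH]; first by rewrite big_ord0 mul0r.
  rewrite mulSn big_split_ord /= -[q.+1]add1n natrD mulrDl mul1r -IH; congr (_ + _).
    by apply: eq_bigr => i _; rewrite modn_small.
  by apply: eq_bigr => i _; rewrite modnDl.
by rewrite H natrM invfM mulrACA divff ?mul1r // pnatr_eq0 expn_eq0.
Qed.

(** With [r <= d], the convention tz(0) = d agrees with divisibility by [2 ^ r]. *)
Lemma tz_ge d r y : (y < 2 ^ d)%N -> (r <= d)%N -> (r <= tz d y)%N = (y %% 2 ^ r == 0)%N.
Proof.
move=> yd rd; rewrite /tz; case: eqP => [->|/eqP y0]; first by rewrite rd mod0n.
by rewrite -[LHS]pfactor_dvdn ?lt0n.
Qed.

Lemma mean_tz_ge_eq {R : realType} d r : (r <= d)%N ->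
  mean (fun y : 'I_(2 ^ d) => (r <= tz d y)%N%:R : R) = (2 ^- r : R).
Proof.
move=> rd; under eq_mean do rewrite tz_ge //.
rewrite (mean_modn (fun z => (z == 0)%N%:R)) // /mean card_ord.
rewrite (bigD1 (Ordinal (expn_gt0 2 r))) //= big1 ?addr0 ?mul1r ?natrX //.
by move=> i; rewrite -val_eqE /= => /negbTE ->.
Qed.

Lemma mean_tz_ge {R : realType} d r :
  mean (fun y : 'I_(2 ^ d) => (r <= tz d y)%N%:R : R) <= (2 ^- r : R).
Proof.
have [rd|dr] := leqP r d; first by rewrite mean_tz_ge_eq.
rewrite (eq_mean (g := fun=> 0)) => [|y]; first by rewrite /mean big1 ?mul0r // invr_ge0 exprn_ge0.
apply/eqP; rewrite pnatr_eq0 eqb0 -ltnNge (leq_ltn_trans _ dr) // /tz.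
case: ifP => // /negbT y0; rewrite -(leq_exp2l (m := 2)) // (leq_trans _ (ltnW (ltn_ord y))) //.
by rewrite dvdn_leq ?lt0n // pfactor_dvdnn.
Qed.

(** * Spectral gap of a regular graph *)


Lemma char_poly_conj (F : fieldType) n (P A : 'M[F]_n) : P \in unitmx ->
  char_poly (invmx P *m A *m P) = char_poly A.
Proof.
move=> Pu; rewrite /char_poly /char_poly_mx.
have e : map_mx polyC (invmx P) *m map_mx polyC P = 1%:M.
  by rewrite -map_mxM mulVmx // map_mx1.
have -> : 'X%:M - map_mx polyC (invmx P *m A *m P) =
   map_mx polyC (invmx P) *m ('X%:M - map_mx polyC A) *m map_mx polyC P.
  rewrite mulmxBr mulmxBl !map_mxM; congr (_ - _).
  by rewrite -[_ *m _ *m _]mulmxA -scalar_mxC mulmxA e mul1mx.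
by rewrite !det_mulmx mulrAC -det_mulmx e det1 mul1r.
Qed.

(** Replaces the sorted list by a count, which is invariant under permutation and so can be carried
    over to the diagonal of the spectral decomposition. *)
Lemma count_sorted_nth1 {R : realType} (t : seq R) (B : R) :
  nth 0 (sort (fun x y => y <= x) t) 1 <= B -> 0 <= B -> (count (> B) t <= 1)%N.
Proof.
move=> h B0; rewrite -(permP (permEl (perm_sort (fun x y => y <= x) t))).
have : sorted (fun x y => y <= x) (sort (fun x y : R => y <= x) t).
  by apply: sort_sorted => x y; exact: le_total.
case: (sort _ t) h => [|x [|y t']] //= h; first by move=> _; case: (_ < _).
move=> /andP[_]; rewrite (path_sortedE _) => [/andP[yt _]|a b c ba ca]; last exact: le_trans ca ba.
rewrite [B < y]ltNge h /= add0n (_ : count _ t' = 0%N) ?addn0; first by case: (_ < _).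
apply/eqP; rewrite -leqn0 leqNgt -has_count; apply/hasPn => z zt /=.
by rewrite -leNgt (le_trans _ h) // (allP yt).
Qed.

Section Spectral.
Variable R : realType.
Local Notation C := R[i].
Local Open Scope complex_scope.
Local Open Scope sesquilinear_scope.
Local Notation toC := (real_complex R).

(** Diagonalise over the complex numbers. The all-ones vector has eigenvalue [D > B], and at most
    one eigenvalue exceeds [B] in modulus, so this vector spans a single coordinate axis of the
    eigenbasis. A vector orthogonal to it only meets eigenvalues of modulus at most [B], and
    Parseval concludes. *)
Lemma symmetric_contraction N (A : 'M[R]_N) (s : seq R) (D B : R) :
  A^T = A -> const_mx 1 *m A = D *: const_mx 1 :> 'rV_N ->
  char_poly A = \prod_(z <- s) ('X - z%:P) ->
  nth 0 (sort (fun x y => y <= x) [seq `|z| | z <- s]) 1 <= B -> 0 <= B -> B < D ->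
  forall v : 'rV[R]_N, \sum_j v 0 j = 0 ->
    \sum_j (v *m A) 0 j ^+ 2 <= B ^+ 2 * \sum_j v 0 j ^+ 2.
Proof.
move=> symA rowA cA sB B0 BD v v1.
case: (posnP N) => [N0|N0].
  by rewrite !big1 ?mulr0 // => -[j lj]; exfalso; rewrite N0 in lj.
pose AC : 'M[C]_N := map_mx toC A.
have nAC : AC \is normalmx.
  apply/hermitian_normalmx/realsym_hermsym.
    apply/is_hermitianmxP; rewrite expr0 scale1r map_mx_id //.
    by apply/matrixP => i j; rewrite !mxE -{1}symA mxE.
  by apply/mxOverP => i j; rewrite mxE complex_real.
set U := spectralmx AC; set e := spectral_diag AC.
have Uu : U \is unitarymx := spectral_unitarymx AC.
have defA : AC = U^t* *m diag_mx e *m U.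
  by rewrite -(invmx_unitary Uu); exact/orthomx_spectralP.
have UtU : U^t* *m U = 1%:M by rewrite -invmx_unitary ?mulVmx ?unitarymx_unit.
(* Both lists are the roots of the same split polynomial, hence equal as multisets. *)
have perm_e : perm_eq [seq e 0 i | i <- enum 'I_N] [seq toC z | z <- s].
  apply: prod_XsubC_eq.
  rewrite !big_map -(map_prod_XsubC toC) -cA map_char_poly -/AC.
  rewrite defA -(invmx_unitary Uu) char_poly_conj ?unitarymx_unit //.
  rewrite char_poly_trig ?diag_mx_is_trig //; apply: eq_bigr => i _.
  by rewrite mxE eqxx.
pose one : 'rV[C]_N := const_mx 1.
pose c := one *m U^t*.
(* The eigenvector equation of the all-ones vector, read in eigenbasis coordinates [c]. *)
have ce i : c 0 i * (e 0 i - toC D) = 0.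
  have : c *m diag_mx e = toC D *: c.
    rewrite -[LHS]mulmx1 -(unitarymxP Uu) !mulmxA -[_ *m _ *m U]mulmxA.
    rewrite /c scalemxAl; congr (_ *m _).
    rewrite -!mulmxA [U^t* *m _]mulmxA -defA.
    have -> : one = map_mx toC (const_mx 1) by rewrite map_const_mx rmorph1.
    by rewrite -map_mxM rowA map_mxZ.
  move=> /rowP/(_ i); rewrite mul_mx_diag !mxE => h.
  by rewrite mulrBr h mulrC subrr.
have [i0 ci0] : exists i0, c 0 i0 != 0.
  apply/existsP; apply: contraT; rewrite negb_exists => /forallP c0.
  have c_0 : c = 0 by apply/rowP => i; rewrite [RHS]mxE; apply/eqP; have := c0 i; rewrite negbK.
  have : one = 0 by rewrite -[one]mulmx1 -UtU mulmxA -/c c_0 mul0mx.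
  by move=> /rowP/(_ (Ordinal N0)); rewrite !mxE => /eqP; rewrite oner_eq0.
have ei0 : e 0 i0 = toC D.
  by have /eqP := ce i0; rewrite mulf_eq0 (negbTE ci0) subr_eq0 => /eqP.
have normR (z : R) : `|toC z| = toC `|z|.
  by rewrite normc_def /= expr0n addr0 sqrtr_sqr.
pose big : pred 'I_N := fun i => toC B < `|e 0 i|.
have cnt : (#|big| <= 1)%N.
  have -> : #|big| = count (fun x : C => toC B < `|x|) [seq e 0 i | i <- enum 'I_N].
    by rewrite count_map cardE size_filter -enumT; apply: eq_count.
  rewrite (permP perm_e) count_map; apply: leq_trans (count_sorted_nth1 sB B0).
  by rewrite count_map; apply/eq_leq/eq_count => z /=; rewrite normR ltcR.
have eB i : i != i0 -> `|e 0 i| <= toC B.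
  move=> ii0; rewrite real_leNgt ?normr_real ?complex_real //; apply/negP => Bi.
  have /card_le1_eqP/(_ i i0) := cnt; rewrite !unfold_in Bi ei0 normR ltcR.
  by rewrite (lt_le_trans BD) ?ler_norm // => /(_ isT isT) /eqP; rewrite eq_sym (negbTE ii0).
have c0 i : i != i0 -> c 0 i = 0.
  move=> ii0; have /eqP := ce i; rewrite mulf_eq0 => /orP[/eqP //|].
  rewrite subr_eq0 => /eqP ei; have := eB i ii0.
  by rewrite ei normR lecR leNgt (lt_le_trans BD) ?ler_norm.
pose y := map_mx toC v *m U^t*.
have adjE (w : 'rV[C]_N) i : (w^t*) i 0 = (w 0 i)^*%R by rewrite mxE mxE.
(* Orthogonality to the all-ones vector, whose only nonzero coordinate is [i0]. *)
have y0 : y 0 i0 = 0.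
  have : (y *m c^t*) 0 0 = 0.
    rewrite /y /c trmx_mul map_mxM trmxCK mulmxA -(mulmxA (map_mx toC v)) UtU mulmx1 mxE.
    rewrite -[RHS](rmorph0 toC) -v1 rmorph_sum; apply: eq_bigr => j _.
    by rewrite !mxE rmorph1 mulr1.
  rewrite mxE (bigD1 i0) //= big1 ?addr0 => [|i ii0]; last by rewrite adjE c0 // rmorph0 mulr0.
  by rewrite adjE => /eqP; rewrite mulf_eq0 conjC_eq0 (negbTE ci0) orbF => /eqP.
have parseval (w : 'rV[R]_N) :
    toC (\sum_j w 0 j ^+ 2) = \sum_i `|(map_mx toC w *m U^t*) 0 i| ^+ 2.
  have : (map_mx toC w *m (map_mx toC w)^t*) 0 0 =
     ((map_mx toC w *m U^t*) *m (map_mx toC w *m U^t*)^t*) 0 0.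
    by rewrite trmx_mul map_mxM trmxCK mulmxA -(mulmxA _ _ U) UtU mulmx1.
  rewrite [LHS]mxE [RHS]mxE => h; rewrite rmorph_sum.
  transitivity (\sum_j map_mx toC w 0 j * (map_mx toC w)^t* j 0).
    apply: eq_bigr => j _; rewrite !mxE rmorphXn /= expr2; congr (_ * _).
    by rewrite conj_Creal ?complex_real.
  by rewrite h; apply: eq_bigr => i _; rewrite adjE -normCK.
rewrite -lecR rmorphM /= !parseval mulr_sumr; apply: ler_sum => i _.
have -> : (map_mx toC (v *m A) *m U^t*) 0 i = y 0 i * e 0 i.
  rewrite map_mxM -/AC defA !mulmxA -/y -mulmxA (unitarymxP Uu) mulmx1.
  by rewrite mul_mx_diag mxE.
rewrite -/y normrM exprMn mulrC rmorphXn; case: (eqVneq i i0) => [->|/eB le].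
  by rewrite y0 normr0 expr0n mulr0 /= mulr0.
by rewrite ler_wpM2r ?exprn_ge0 // lerXn2r ?nnegrE // (le_trans _ le).
Qed.
End Spectral.

(** * Exponential moments along a walk *)


Lemma cauchy_schwarz {R : realType} {V : finType} (f g : V -> R) :
  (\sum_x f x * g x) ^+ 2 <= (\sum_x f x ^+ 2) * (\sum_x g x ^+ 2).
Proof.
set fg := \sum_x _; set ff := \sum_x f x ^+ 2; set gg := \sum_x g x ^+ 2.
have [gg0|ggN0] := eqVneq gg 0.
  have g0 x : g x = 0.
    apply/eqP; rewrite -sqrf_eq0; move/eqP: gg0; rewrite psumr_eq0 => [/allP|i _].
      by move=> /(_ x); rewrite mem_index_enum => /(_ isT).
    exact: sqr_ge0.
  by rewrite /fg big1 ?expr0n ?gg0 ?mulr0 // => x _; rewrite g0 mulr0.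
have gg_gt0 : 0 < gg by rewrite lt_def ggN0 sumr_ge0 // => x _; exact: sqr_ge0.
have : 0 <= \sum_x (gg * f x - fg * g x) ^+ 2 by apply: sumr_ge0 => x _; exact: sqr_ge0.
have -> : \sum_x (gg * f x - fg * g x) ^+ 2 = gg * (gg * ff - fg ^+ 2).
  transitivity (\sum_x (gg ^+ 2 * f x ^+ 2 + (- 2 * gg * fg) * (f x * g x) + fg ^+ 2 * g x ^+ 2)).
    by apply: eq_bigr => x _; ring.
  by rewrite !big_split /= -!mulr_sumr -/ff -/gg -/fg; ring.
by rewrite pmulr_rge0 // subr_ge0 mulrC.
Qed.

(** The triangle inequality for the Euclidean norm, kept in squared form so that no square root of
    [Y] appears. *)
Lemma minkowski_sq {R : realType} {V : finType} (f g : V -> R) (p q Y : R) :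
  0 <= p -> 0 <= q -> 0 <= Y ->
  \sum_x f x ^+ 2 <= p ^+ 2 * Y -> \sum_x g x ^+ 2 <= q ^+ 2 * Y ->
  \sum_x (f x + g x) ^+ 2 <= (p + q) ^+ 2 * Y.
Proof.
move=> p0 q0 Y0 hf hg.
have fg : \sum_x f x * g x <= p * q * Y.
  apply: le_trans (ler_norm _) _; rewrite -ler_sqr ?nnegrE ?mulr_ge0 //.
  rewrite real_normK ?num_real // (le_trans (cauchy_schwarz f g)) //.
  have -> : (p * q * Y) ^+ 2 = (p ^+ 2 * Y) * (q ^+ 2 * Y) by ring.
  by apply: ler_pM => //; apply: sumr_ge0 => x _; exact: sqr_ge0.
have -> : \sum_x (f x + g x) ^+ 2 =
    \sum_x f x ^+ 2 + 2 * (\sum_x f x * g x) + \sum_x g x ^+ 2.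
  by rewrite mulr_sumr -!big_split; apply: eq_bigr => x _ /=; ring.
have -> : (p + q) ^+ 2 * Y = p ^+ 2 * Y + 2 * (p * q * Y) + q ^+ 2 * Y by ring.
by rewrite !lerD // ler_pM2l.
Qed.

Section Walk.
Context {R : realType} {V : finType}.
Variables (a : V -> V -> nat) (d : nat) (lam : R).
Hypotheses (d_gt0 : (0 < d)%N) (lam_ge0 : 0 <= lam) (lam_lt1 : lam < 1).
Hypothesis exp_a : expander a d lam.

Definition transition (u v : V) : R := (a u v)%:R / d%:R.

Let symM u v : transition u v = transition v u.
Proof. by rewrite /transition exp_a.1.1. Qed.

Let dN0 : d%:R != 0 :> R.
Proof. by rewrite pnatr_eq0 -lt0n. Qed.

Lemma sum_trans u : \sum_v transition u v = 1.
Proof. by rewrite -mulr_suml -natr_sum exp_a.1.2 divff. Qed.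

Lemma expander_contraction (phi : V -> R) : \sum_v phi v = 0 ->
  \sum_u (\sum_v transition u v * phi v) ^+ 2 <= lam ^+ 2 * \sum_v phi v ^+ 2.
Proof.
case: exp_a => -[syma rega] [s [cs ss]] phi0.
have d0 : 0 < d%:R :> R by rewrite ltr0n.
pose v : 'rV[R]_#|V| := \row_i phi (enum_val i).
have sumV (F : V -> R) : \sum_(i < #|V|) F (enum_val i) = \sum_v F v.
  by rewrite [RHS](reindex (@enum_val V predT)) //; apply: onW_bij; exact: enum_val_bij.
have /= := @symmetric_contraction R #|V| (adj_mx a) s d%:R (d%:R * lam) _ _ cs ss _ _ v.
have -> : \sum_j v 0 j = 0.
  by rewrite -[RHS]phi0 -sumV; apply: eq_bigr => i _; rewrite mxE.
have -> : \sum_j v 0 j ^+ 2 = \sum_v phi v ^+ 2.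
  by rewrite -[RHS]sumV; apply: eq_bigr => i _; rewrite mxE.
have -> : \sum_j (v *m adj_mx a) 0 j ^+ 2 =
    d%:R ^+ 2 * \sum_u (\sum_v transition u v * phi v) ^+ 2.
  rewrite mulr_sumr -[RHS]sumV; apply: eq_bigr => i _; rewrite mxE -exprMn; congr (_ ^+ 2).
  rewrite mulr_sumr -[RHS]sumV; apply: eq_bigr => j _; rewrite !mxE syma.
  by rewrite /transition; field.
move=> h; rewrite -(ler_pM2l (exprn_gt0 2 d0)) mulrA -exprMn; apply: h => //.
- by apply/matrixP => i j; rewrite !mxE syma.
- apply/rowP => i; rewrite !mxE.
  under eq_bigr do rewrite !mxE mul1r syma.
  by rewrite (sumV (fun v => (a (enum_val i) v)%:R)) -natr_sum rega mulr1.
- by rewrite mulr_ge0.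
- by rewrite -[ltRHS]mulr1 ltr_pM2l.
Qed.

(** The symmetric operator sqrt(W) M sqrt(W) has norm at most [mean W + lam * K]. Split sqrt(W) phi
    into its mean and a centred part: Cauchy-Schwarz gives [mean W] for the first, and for the
    second the contraction gives [lam] while the two factors sqrt(W) give [K]. *)
Lemma weighted_step_norm (W phi : V -> R) (K : R) :
  (forall v, 0 <= W v) -> (forall v, W v <= K) ->
  \sum_u (Num.sqrt (W u) * \sum_v transition u v * (Num.sqrt (W v) * phi v)) ^+ 2
  <= (mean W + lam * K) ^+ 2 * \sum_v phi v ^+ 2.
Proof.
move=> W0 WK; case: (posnP #|V|) => [V0|V0].
  by rewrite !big1 ?mulr0 // => v _; have := card0_eq V0 v.
have [v0 _] := card_gt0P V0.
have K0 : 0 <= K := le_trans (W0 v0) (WK v0).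
pose psi v := Num.sqrt (W v) * phi v; pose m := mean psi.
have N0 : 0 < #|V|%:R :> R by rewrite ltr0n.
have Y0 : 0 <= \sum_v phi v ^+ 2 by apply: sumr_ge0 => v _; exact: sqr_ge0.
under eq_bigr => u _.
  have -> : Num.sqrt (W u) * \sum_v transition u v * (Num.sqrt (W v) * phi v) =
     Num.sqrt (W u) * m + Num.sqrt (W u) * \sum_v transition u v * (psi v - m).
    rewrite -mulrDr; congr (_ * _).
    under [in RHS]eq_bigr do rewrite mulrBr.
    by rewrite sumrB -mulr_suml sum_trans mul1r addrC subrK.
  over.
have sqW u : Num.sqrt (W u) ^+ 2 = W u by rewrite sqr_sqrtr.
apply: minkowski_sq => //; [exact: mean_ge0 | exact: mulr_ge0 | |].
  under eq_bigr do rewrite exprMn sqW.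
  rewrite -mulr_suml /m /mean expr_div_n.
  have h : (\sum_x psi x) ^+ 2 <= (\sum_v W v) * \sum_v phi v ^+ 2.
    rewrite (le_trans (cauchy_schwarz (fun v => Num.sqrt (W v)) phi)) //.
    by under eq_bigr do rewrite sqW.
  have S0 : 0 <= \sum_v W v by exact: sumr_ge0.
  rewrite expr_div_n [leRHS]mulrAC mulrA ler_pM2r ?invr_gt0 ?exprn_gt0 //.
  by rewrite expr2 -mulrA ler_wpM2l.
under eq_bigr do rewrite exprMn sqW.
have psi0 : \sum_v (psi v - m) = 0.
  rewrite sumrB sumr_const -[m *+ _]mulr_natr /m /mean mulfVK ?subrr //.
  by rewrite pnatr_eq0 -lt0n.
(* Centring is an orthogonal projection, so it does not increase the norm. *)
have cle : \sum_v (psi v - m) ^+ 2 <= \sum_v psi v ^+ 2.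
  have -> : \sum_v (psi v - m) ^+ 2 = \sum_v psi v ^+ 2 - m ^+ 2 * #|V|%:R.
    transitivity (\sum_v (psi v ^+ 2 - 2 * m * (psi v - m) - m ^+ 2)).
      by apply: eq_bigr => v _; ring.
    by rewrite !sumrB -mulr_sumr psi0 mulr0 subr0 [X in _ - X]sumr_const mulr_natr.
  by rewrite gerBl mulr_ge0 ?sqr_ge0.
apply: (@le_trans _ _ (K * \sum_u (\sum_v transition u v * (psi v - m)) ^+ 2)).
  by rewrite mulr_sumr; apply: ler_sum => u _; rewrite ler_wpM2r ?sqr_ge0.
have -> : (lam * K) ^+ 2 * \sum_v phi v ^+ 2 = K * (lam ^+ 2 * (K * \sum_v phi v ^+ 2)) by ring.
rewrite ler_wpM2l // (le_trans (expander_contraction psi0)) // ler_wpM2l ?sqr_ge0 //.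
rewrite (le_trans cle) // mulr_sumr; apply: ler_sum => v _.
by rewrite /psi exprMn sqW ler_wpM2r ?sqr_ge0.
Qed.

(** The expectation of [G] over the next [m] vertices of a walk at [v]. Peeling off one step at a
    time makes induction on the length possible, which the product over a zipped tuple does not. *)
Fixpoint walk_from (m : nat) (v : V) (G : seq V -> R) : R :=
  if m is m'.+1 then \sum_u transition v u * walk_from m' u (fun t => G (u :: t))
  else G [::].

Lemma walk_fromE m v (G : seq V -> R) :
  \sum_(t : m.-tuple V) (\prod_(uv <- zip (v :: t) t) transition uv.1 uv.2) * G t =
  walk_from m v G.
Proof.
elim: m v G => [|m IH] v G /=.
  rewrite (big_pred1 [tuple]) => [|t]; last by apply/esym/eqP/val_inj; case: t => -[].
  by rewrite /= big_nil mul1r.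
rewrite (reindex (fun p : V * m.-tuple V => [tuple of p.1 :: p.2])) /=; last first.
  exists (fun t : m.+1.-tuple V => (thead t, [tuple of behead t])) => [[u t] _|t _].
    by congr (_, _); apply/val_inj.
  by rewrite /= -tuple_eta.
rewrite -(pair_bigA _ (fun u (t : m.-tuple V) =>
   (\prod_(uv <- zip (v :: u :: t) (u :: t)) transition uv.1 uv.2) * G (u :: t))) /=.
apply: eq_bigr => u _; rewrite -IH mulr_sumr; apply: eq_bigr => t _.
by rewrite big_cons /= mulrA.
Qed.

Lemma walk_sumE L (G : seq V -> R) :
  \sum_(w : L.+1.-tuple V) walk_weight a d w * G w =
  mean (fun v => walk_from L v (fun t => G (v :: t))).
Proof.
rewrite (reindex (fun p : V * L.-tuple V => [tuple of p.1 :: p.2])) /=; last first.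
  exists (fun t : L.+1.-tuple V => (thead t, [tuple of behead t])) => [[u t] _|t _].
    by congr (_, _); apply/val_inj.
  by rewrite /= -tuple_eta.
rewrite -(pair_bigA _ (fun u (t : L.-tuple V) =>
   walk_weight a d [tuple of u :: t] * G (u :: t))) /= /mean mulr_suml.
apply: eq_bigr => v _; rewrite -walk_fromE mulr_suml; apply: eq_bigr => t _.
by rewrite /walk_weight /= [RHS]mulrC [RHS]mulrA.
Qed.

Lemma eq_walk_from m v (G H : seq V -> R) : G =1 H -> walk_from m v G = walk_from m v H.
Proof.
elim: m v G H => [|m IH] v G H GH /=; first exact: GH.
by apply: eq_bigr => u _; congr (_ * _); apply: IH => t; exact: GH.
Qed.

Lemma walk_fromZ m v c (G : seq V -> R) :
  walk_from m v (fun t => c * G t) = c * walk_from m v G.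
Proof.
elim: m v G => [|m IH] v G //=.
by rewrite mulr_sumr; apply: eq_bigr => u _; rewrite IH mulrCA.
Qed.

Lemma walk_fromD m v (G H : seq V -> R) :
  walk_from m v (fun t => G t + H t) = walk_from m v G + walk_from m v H.
Proof.
elim: m v G H => [|m IH] v G H //=.
by rewrite -big_split; apply: eq_bigr => u _ /=; rewrite IH mulrDr.
Qed.

Lemma walk_from1 m v c : walk_from m v (fun=> c) = c.
Proof.
elim: m v => [|m IH] v //=.
by under eq_bigr do rewrite IH; rewrite -mulr_suml sum_trans mul1r.
Qed.

Lemma mean_trans (phi : V -> R) : mean (fun v => \sum_u transition v u * phi u) = mean phi.
Proof.
rewrite /mean exchange_big /=; congr (_ / _); apply: eq_bigr => u _.
by rewrite -mulr_suml; under eq_bigr do rewrite symM; rewrite sum_trans mul1r.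
Qed.

(** The uniform distribution is stationary, so each vertex of the walk is uniform. *)
Lemma walk_mean_sum L (g : V -> R) :
  \sum_(w : L.-tuple V) walk_weight a d w * (\sum_(v <- w) g v) = L%:R * mean g.
Proof.
case: L => [|L].
  by rewrite mul0r big1 // => w _; rewrite tuple0 big_nil mulr0.
rewrite (walk_sumE L (fun w => \sum_(v <- w) g v)).
elim: L => [|L IH] /=.
  by rewrite mul1r; apply: eq_mean => v; rewrite big_cons big_nil addr0.
rewrite -[L.+2%:R]natr1 addrC mulrDl mul1r -IH -[X in _ = _ + X]mean_trans -meanD /=.
apply: eq_mean => v.
under eq_bigr => u _.
  rewrite (@eq_walk_from _ _ _ (fun t => g v + \sum_(x <- u :: t) g x)); last first.
    by move=> t; rewrite big_cons.
  rewrite walk_fromD walk_from1 mulrDr; over.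
by rewrite big_split /= -mulr_suml sum_trans mul1r.
Qed.

(** Sharing each weight between its two adjacent steps writes the expectation as the inner product
    of [r] = sqrt(W) with a power of [T] applied to [r], divided by [#|V|]. Cauchy-Schwarz and the
    norm bound on [T] finish. *)
Lemma walk_mgf L (W : V -> R) (K : R) : (0 < L)%N -> 0 <= K ->
  (forall v, 0 <= W v) -> (forall v, W v <= K) ->
  \sum_(w : L.-tuple V) walk_weight a d w * (\prod_(v <- w) W v)
  <= (mean W + lam * K) ^+ L.
Proof.
case: L => // L _ K0 W0 WK; set kap := _ + _.
have kap0 : 0 <= kap by rewrite addr_ge0 ?mean_ge0 // mulr_ge0.
rewrite (walk_sumE L (fun w => \prod_(v <- w) W v)).
pose r v := Num.sqrt (W v).
pose T (phi : V -> R) u := r u * \sum_v transition u v * (r v * phi v).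
have sqW u : r u ^+ 2 = W u by rewrite sqr_sqrtr.
have iterE m v : r v * walk_from m v (fun t => \prod_(x <- t) W x) = iter m T r v.
  elim: m v => [|m IH] v /=; first by rewrite big_nil mulr1.
  rewrite /T; congr (_ * _); apply: eq_bigr => u _; congr (_ * _).
  rewrite -IH mulrA -expr2 sqW -walk_fromZ; apply: eq_walk_from => t.
  by rewrite big_cons.
have normT m : \sum_v iter m T r v ^+ 2 <= (kap ^+ m) ^+ 2 * \sum_v r v ^+ 2.
  elim: m => [|m IH]; first by rewrite expr0 expr1n mul1r.
  rewrite iterS (le_trans (weighted_step_norm (iter m T r) W0 WK)) // -/kap.
  by rewrite [kap ^+ m.+1]exprS exprMn -[leRHS]mulrA ler_wpM2l ?sqr_ge0.
have -> : mean (fun v => walk_from L v (fun t => \prod_(x <- v :: t) W x)) =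
    mean (fun v => r v * iter L T r v).
  apply: eq_mean => v; rewrite -iterE mulrA -expr2 sqW -walk_fromZ.
  by apply: eq_walk_from => t; rewrite big_cons.
(* [L] is now one less than the number of vertices; the two end factors [r] supply the remaining
   [mean W <= kap]. *)
apply: (@le_trans _ _ (mean W * kap ^+ L)); last first.
  by rewrite exprS ler_wpM2r ?exprn_ge0 // lerDl mulr_ge0.
rewrite /mean mulrAC ler_wpM2r ?invr_ge0 //.
have SW0 : 0 <= \sum_v W v by exact: sumr_ge0.
apply: le_trans (ler_norm _) _; rewrite -ler_sqr ?nnegrE ?mulr_ge0 ?exprn_ge0 //.
rewrite real_normK ?num_real // (le_trans (cauchy_schwarz _ _)) //.
under eq_bigr do rewrite sqW.
rewrite exprMn expr2 -mulrA ler_wpM2l // mulrC (le_trans (normT L)) //.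
by under eq_bigr do rewrite sqW.
Qed.
End Walk.

(** * Balls into bins *)


(** The first [k] terms of the binomial expansion of [(1 - x) ^+ n]; at [x = 1] it is
    inclusion-exclusion over [n] events that all occur. *)
Definition altbin {R : realType} (k n : nat) (x : R) : R :=
  \sum_(m < k) (-1) ^+ m * 'C(n, m)%:R * x ^+ m.

Lemma altbinS {R : realType} k n (x : R) :
  altbin k.+1 n.+1 x = altbin k.+1 n x - x * altbin k n x.
Proof.
rewrite /altbin [in LHS]big_ord_recl [X in _ = X - _]big_ord_recl /= !bin0.
rewrite -addrA; congr (_ + _); rewrite mulr_sumr -sumrB; apply: eq_bigr => i _.
by rewrite /bump /= !add1n binS natrD !exprS; ring.
Qed.

(* At [x = 1] the left-hand power is the indicator of [n = 0], so this one *)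
(* bound gives both the truncated binomial expansion and the pointwise     *)
(* Bonferroni inequality.                                                  *)
Lemma altbin_error {R : realType} k n (x : R) : 0 <= x <= 1 ->
  `|(1 - x) ^+ n - altbin k n x| <= 'C(n, k)%:R * x ^+ k.
Proof.
move=> /andP[x0 x1]; elim: n k => [|n IH] [|k].
- by rewrite /altbin big_ord0 subr0 normr1 !expr0 mulr1.
- rewrite /altbin big_ord_recl /= bin0 !expr0 !mulr1 big1 => [|i _]; last by rewrite mulr0 mul0r.
  by rewrite addr0 subrr normr0 mul0r.
- rewrite /altbin big_ord0 subr0 bin0 expr0 mulr1 ger0_norm ?exprn_ge0 ?subr_ge0 //.
  by rewrite exprn_ile1 ?subr_ge0 // gerBl.
- have -> : (1 - x) ^+ n.+1 - altbin k.+1 n.+1 x =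
     ((1 - x) ^+ n - altbin k.+1 n x) - x * ((1 - x) ^+ n - altbin k n x).
    by rewrite altbinS exprS; ring.
  rewrite (le_trans (ler_normB _ _)) // normrM (ger0_norm x0) binS natrD mulrDl lerD //.
  by rewrite exprS mulrCA ler_wpM2l.
Qed.

(** Mean-value bounds for the power [t ^+ n.+1], from above here and from below in the next
    lemma. *)
Lemma powB_le {R : realType} n (u v : R) : 0 <= v -> v <= u ->
  u ^+ n.+1 - v ^+ n.+1 <= n.+1%:R * (u - v) * u ^+ n.
Proof.
move=> v0 vu; have u0 := le_trans v0 vu; elim: n => [|n IH].
  by rewrite !expr1 expr0 mulr1 mul1r.
have -> : u ^+ n.+2 - v ^+ n.+2 = u ^+ n.+1 * (u - v) + v * (u ^+ n.+1 - v ^+ n.+1).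
  by rewrite ![_ ^+ n.+2]exprS; ring.
have h1 : v * (u ^+ n.+1 - v ^+ n.+1) <= u * (n.+1%:R * (u - v) * u ^+ n).
  apply: ler_pM => //; by rewrite subr_ge0 lerXn2r.
apply: (le_trans (lerD (lexx _) h1)).
by rewrite -[n.+2%:R]natr1 exprS le_eqVlt; apply/orP; left; apply/eqP; ring.
Qed.

Lemma powB_ge {R : realType} n (u v : R) : 0 <= v -> v <= u ->
  n.+1%:R * (u - v) * v ^+ n <= u ^+ n.+1 - v ^+ n.+1.
Proof.
move=> v0 vu; have u0 := le_trans v0 vu; elim: n => [|n IH].
  by rewrite !expr1 expr0 mulr1 mul1r.
have -> : u ^+ n.+2 - v ^+ n.+2 = u ^+ n.+1 * (u - v) + v * (u ^+ n.+1 - v ^+ n.+1).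
  by rewrite ![_ ^+ n.+2]exprS; ring.
have h1 : v * (n.+1%:R * (u - v) * v ^+ n) <= v * (u ^+ n.+1 - v ^+ n.+1).
  exact: ler_wpM2l.
have h2 : v ^+ n.+1 * (u - v) <= u ^+ n.+1 * (u - v).
  by rewrite ler_wpM2r ?subr_ge0 // lerXn2r.
apply: le_trans (lerD h2 h1).
by rewrite -[n.+2%:R]natr1 exprS le_eqVlt; apply/orP; left; apply/eqP; ring.
Qed.

(** The left side is the variance of the number of empty bins under full independence. A bound of
    order [n ^ 2 / b], not [n], is needed: a relative error [eta] then fails with probability of
    order [1 / (b * eta ^ 2)], however small [n] is. *)
Lemma empty_bins_variance {R : realType} (b n : nat) : (2 <= b)%N ->
  b%:R * (1 - b%:R^-1) ^+ n + b%:R * (b%:R - 1) * (1 - 2 / b%:R) ^+ n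
    - (b%:R * (1 - b%:R^-1) ^+ n) ^+ 2 <= n%:R ^+ 2 / b%:R :> R.
Proof.
move=> b2.
have b_gt0 : 0 < b%:R :> R by rewrite ltr0n; lia.
have bge2 : 2 <= b%:R :> R by rewrite (ler_nat _ 2 b).
pose x : R := b%:R^-1.
have x0 : 0 <= x by rewrite invr_ge0 ltW.
have bx : b%:R * x = 1 by rewrite divff ?gt_eqF.
have x2 : 0 <= 1 - 2 * x.
  rewrite subr_ge0 -(ler_pM2l b_gt0) mulrCA bx; lra.
rewrite -/x; case: n => [|n].
  by rewrite !expr0 expr0n /= mul0r; nra.
set u := (1 - x) ^+ n.+1; set v := (1 - 2 * x) ^+ n.+1.
have h1 : u - v <= n.+1%:R * x * (1 - x) ^+ n.
  have := @powB_le R n (1 - x) (1 - 2 * x) x2.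
  by rewrite (_ : 1 - x - (1 - 2 * x) = x); [apply; lra | ring].
have h2 : n.+1%:R * x ^+ 2 * (1 - 2 * x) ^+ n <= u ^+ 2 - v.
  have := @powB_ge R n ((1 - x) ^+ 2) (1 - 2 * x) x2.
  rewrite -exprM mulnC exprM -/u -/v (_ : (1 - x) ^+ 2 - (1 - 2 * x) = x ^+ 2); last by ring.
  by apply; rewrite -subr_ge0 (_ : _ - _ = x ^+ 2) ?sqr_ge0 //; ring.
have h3 : (1 - x) ^+ n - (1 - 2 * x) ^+ n <= n%:R * x.
  case: (n) => [|m]; first by rewrite !expr0 subrr mul0r.
  have := @powB_le R m (1 - x) (1 - 2 * x) x2.
  rewrite (_ : 1 - x - (1 - 2 * x) = x); last by ring.
  move=> /(_ ltac:(lra)) /le_trans; apply.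
  rewrite -[leRHS]mulr1 ler_wpM2l ?mulr_ge0 // exprn_ile1 //; lra.
(* Grouped so that both differences contribute the same factor [n.+1]; the leading terms cancel and
   [h3] bounds what is left. *)
have -> : b%:R * u + b%:R * (b%:R - 1) * v - (b%:R * u) ^+ 2 =
   b%:R * (u - v) - b%:R ^+ 2 * (u ^+ 2 - v) by ring.
apply: (@le_trans _ _ (n.+1%:R * ((1 - x) ^+ n - (1 - 2 * x) ^+ n))).
  have e1 : b%:R * (n.+1%:R * x * (1 - x) ^+ n) = n.+1%:R * (1 - x) ^+ n.
    by transitivity (b%:R * x * (n.+1%:R * (1 - x) ^+ n)); [ring | rewrite bx mul1r].
  have e2 : b%:R ^+ 2 * (n.+1%:R * x ^+ 2 * (1 - 2 * x) ^+ n) = n.+1%:R * (1 - 2 * x) ^+ n.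
    transitivity ((b%:R * x) ^+ 2 * (n.+1%:R * (1 - 2 * x) ^+ n)); first by ring.
    by rewrite bx expr1n mul1r.
  rewrite [leRHS]mulrBr; apply: lerB.
    by rewrite -e1 ler_pM2l.
  by rewrite -e2 ler_pM2l ?exprn_gt0.
rewrite expr2 -/x -mulrA ler_wpM2l // (le_trans h3) // ler_wpM2r //.
by rewrite ler_nat.
Qed.

(** The base is [4 / 3 * 2]: it beats both the bound [4 / 3] on the expected load of two bins and
    the factor [2 ^+ k >= b]. The inequality fails at [k = 5], hence the recurring [6 <= k]. *)
Lemma fact_ge_pow83 {R : realType} k : (6 <= k)%N -> (8 / 3) ^+ k <= k`!%:R :> R.
Proof.
elim: k => // k IH; rewrite leq_eqVlt => /orP[/eqP <-|k6].
  by rewrite (_ : 6`! = 720)%N //; lra.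
rewrite exprS factS natrM; apply: ler_pM; [lra | by rewrite exprn_ge0 //; lra | | exact: IH].
have : 3 <= k.+1%:R :> R by rewrite ler_nat; lia.
lra.
Qed.

(** The truncation error for a pair of bins, summed over [b ^ 2] pairs, stays of the order of the
    variance. Two of the [k] factors [z = 2 * n / b] are kept to produce [n ^ 2], the others are
    bounded by [4 / 3]. *)
Lemma bin_tail_bound {R : realType} (b n k : nat) :
  (0 < b)%N -> (6 <= k)%N -> (b <= 2 ^ k)%N -> (3 * n <= 2 * b)%N ->
  b%:R ^+ 2 * ('C(n, k)%:R * (2 / b%:R) ^+ k) <= 9 / 4 * (n%:R ^+ 2 / b%:R) :> R.
Proof.
move=> b0 k6 bk nb.
have b_gt0 : 0 < b%:R :> R by rewrite ltr0n.
have t0 : 0 <= 2 / b%:R :> R by rewrite divr_ge0 // ltW.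
set t : R := 2 / b%:R in t0 *; set z : R := n%:R * t.
have z0 : 0 <= z by rewrite mulr_ge0.
have zle : z <= 4 / 3.
  rewrite /z /t mulrA ler_pdivrMr //.
  have : (3 * n)%:R <= (2 * b)%:R :> R by rewrite ler_nat.
  by rewrite !natrM; lra.
have kf0 : 0 < k`!%:R :> R by rewrite ltr0n fact_gt0.
have h1 : 'C(n, k)%:R * t ^+ k <= z ^+ k / k`!%:R.
  rewrite ler_pdivlMr // /z [(_ * t) ^+ k]exprMn mulrAC ler_wpM2r ?exprn_ge0 //.
  rewrite -natrM bin_ffact -natrX ler_nat; elim: (k) => [|m IH] //.
  by rewrite ffactnSr expnSr leq_mul // leq_subr.
have h2 : z ^+ k <= z ^+ 2 * (4 / 3) ^+ (k - 2).
  rewrite -{1}(subnKC (_ : 2 <= k)%N) ?exprD; last lia.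
  by rewrite ler_wpM2l ?sqr_ge0 // lerXn2r ?nnegrE //; lra.
have h3 : (4 / 3) ^+ k / k`!%:R <= b%:R^-1 :> R.
  rewrite ler_pdivrMr // [leRHS]mulrC ler_pdivlMr //.
  apply: le_trans (fact_ge_pow83 k6).
  have -> : 8 / 3 = 4 / 3 * 2 :> R by lra.
  rewrite [leRHS]exprMn ler_wpM2l ?exprn_ge0 //.
  by rewrite -natrX ler_nat.
have e4 : (4 / 3) ^+ k = (16 / 9) * (4 / 3) ^+ (k - 2) :> R.
  rewrite -{1}(subnKC (_ : 2 <= k)%N) ?exprD; last lia.
  by congr (_ * _); lra.
apply: (@le_trans _ _ (b%:R ^+ 2 * (z ^+ 2 * (4 / 3) ^+ (k - 2) / k`!%:R))).
  rewrite ler_wpM2l ?sqr_ge0 // (le_trans h1) // ler_wpM2r // invr_ge0 ltW //.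
have -> : b%:R ^+ 2 * (z ^+ 2 * (4 / 3) ^+ (k - 2) / k`!%:R) =
    9 / 4 * (n%:R ^+ 2 * ((4 / 3) ^+ k / k`!%:R)).
  rewrite e4 /z /t; field; apply/andP; split; exact: lt0r_neq0.
by rewrite ler_wpM2l // ?ler_wpM2l ?sqr_ge0 //; lra.
Qed.

Section BallsIntoBins.
Context {R : realType} {Om : finType}.
Variables (N b k : nat) (h : Om -> 'I_N -> 'I_b) (U : {set 'I_N}).
Hypothesis Om_gt0 : (0 < #|Om|)%N.
Hypothesis indep : forall (S : {set 'I_N}) (J : {set 'I_b}), (#|S| <= k)%N ->
  mean (fun o => \prod_(x in S) (h o x \in J)%:R) = (#|J|%:R / b%:R) ^+ #|S| :> R.
Let n := #|U|.

Definition load (J : {set 'I_b}) (o : Om) := #|[set x in U | h o x \in J]|.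

(** The binomial coefficient counts the [m]-subsets of [U] sent into [J], and [k]-wise independence
    gives the probability of each. Up to order [k] these moments are those of full independence. *)
Lemma mean_bin_load J m : (m <= k)%N ->
  mean (fun o => 'C(load J o, m)%:R) = 'C(n, m)%:R * (#|J|%:R / b%:R) ^+ m :> R.
Proof.
move=> mk.
have -> : mean (fun o => 'C(load J o, m)%:R : R) =
   mean (fun o => \sum_(S : {set 'I_N} | (S \subset U) && (#|S| == m))
                    \prod_(x in S) (h o x \in J)%:R).
  apply: eq_mean => o; rewrite -cards_draws -sum1_card natr_sum.
  rewrite [LHS](eq_bigl (fun S : {set 'I_N} => ((S \subset U) && (#|S| == m)) &&
      [forall x in S, h o x \in J])) => [|S]; last first.
    rewrite inE.
    have -> : [set x in U | h o x \in J] = U :&: [set x | h o x \in J].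
      by apply/setP => x; rewrite !inE.
    rewrite finset.subsetI -!andbA; congr (_ && _); rewrite andbC; congr (_ && _).
    apply/fintype.subsetP/forall_inP => H x /H; by rewrite inE.
  rewrite big_mkcondr /=; apply: eq_bigr => S _; case: ifPn => [/forall_inP H|].
    by rewrite big1 // => x /H ->.
  rewrite negb_forall_in => /exists_inP[x xS /negbTE hx].
  by rewrite (bigD1 x) //= hx mul0r.
rewrite mean_sum /=.
rewrite (eq_bigr (fun=> (#|J|%:R / b%:R) ^+ m)) => [|S /andP[_ /eqP Sm]]; last first.
  by rewrite indep Sm.
rewrite (eq_bigl (mem [set S : {set 'I_N} | (S \subset U) && (#|S| == m)])) => [|S]; last first.
  by rewrite /= inE.
rewrite sumr_const cards_draws.
by rewrite -[LHS]mulr_natl.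
Qed.

(** The truncated sums agree in expectation, so the error is incurred only in truncating twice:
    pointwise for the indicator, and in the expansion of the power. This explains the factor 2. *)
Lemma mean_empty (J : {set 'I_b}) : (0 < b)%N ->
  `|mean (fun o => (load J o == 0)%:R) - (1 - #|J|%:R / b%:R) ^+ n|
  <= 2 * ('C(n, k)%:R * (#|J|%:R / b%:R) ^+ k) :> R.
Proof.
move=> b0; set x := #|J|%:R / b%:R.
have x01 : 0 <= x <= 1.
  rewrite divr_ge0 //= ler_pdivrMr ?ltr0n // mul1r ler_nat.
  by rewrite (leq_trans (max_card _)) ?card_ord.
have altE : mean (fun o => altbin k (load J o) 1) = altbin k n x.
  rewrite /altbin mean_sum; apply: eq_bigr => m _.
  under eq_mean do rewrite expr1n mulr1.
  by rewrite meanZ mean_bin_load ?mulrA // ltnW.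
have e1 : `|mean (fun o => (load J o == 0)%:R) - altbin k n x| <= 'C(n, k)%:R * x ^+ k.
  have pw o : `|(load J o == 0)%:R - altbin k (load J o) (1 : R)| <= 'C(load J o, k)%:R.
    have := @altbin_error R k (load J o) 1; rewrite ler01 lexx => /(_ isT).
    by rewrite subrr expr0n expr1n mulr1.
  rewrite -altE -mean_bin_load //.
  have l1 : mean (fun o => (load J o == 0)%:R) <=
      mean (fun o => altbin k (load J o) 1) + mean (fun o => 'C(load J o, k)%:R) :> R.
    by rewrite -meanD; apply: ler_mean => o; have := pw o; rewrite ler_norml => /andP[_]; lra.
  have l2 : mean (fun o => altbin k (load J o) 1) <=
      mean (fun o => (load J o == 0)%:R) + mean (fun o => 'C(load J o, k)%:R) :> R.
    by rewrite -meanD; apply: ler_mean => o; have := pw o; rewrite ler_norml => /andP[+ _]; lra.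
  by rewrite ler_norml; apply/andP; split; lra.
have e2 := altbin_error k n x01; rewrite distrC in e2.
rewrite mulrDl mul1r.
exact: le_trans (ler_distD (altbin k n x) _ _) (lerD e1 e2).
Qed.

Definition occupied (o : Om) : {set 'I_b} := h o @: U.

Lemma load_set1 o j : (load [set j] o == 0)%N = (j \notin occupied o).
Proof.
rewrite /load cards_eq0; apply/eqP/idP => [e|].
  apply/negP => /imsetP[x xU je]; have := finset.in_set0 x.
  by rewrite -e !inE xU je eqxx.
move=> jN; apply/setP => x; rewrite !inE; apply/negP => /andP[xU /eqP e].
by move/negP: jN; apply; rewrite -e imset_f.
Qed.

Lemma load_set2 o i j :
  (load [set i] o == 0)%N && (load [set j] o == 0)%N = (load [set i; j] o == 0)%N.
Proof.
rewrite /load !cards_eq0 -finset.setU_eq0; congr (_ == _); apply/setP => x.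
by rewrite !inE -andb_orr.
Qed.

(** Expanding the square only involves single bins and pairs of bins, each within [e] of full
    independence. *)
Lemma mean_occupied_sq :
  (2 <= b)%N -> (6 <= k)%N -> (b <= 2 ^ k)%N -> (3 * n <= 2 * b)%N ->
  mean (fun o => (#|occupied o|%:R - b%:R * (1 - (1 - b%:R^-1) ^+ n)) ^+ 2)
  <= 15 * (n%:R ^+ 2 / b%:R) :> R.
Proof.
move=> b2 k6 bk nb.
have b0 : (0 < b)%N by lia.
have b_gt0 : 0 < b%:R :> R by rewrite ltr0n.
set y : R := (1 - b%:R^-1) ^+ n.
pose E j o : R := (load [set j] o == 0)%:R.
pose e : R := 2 * ('C(n, k)%:R * (2 / b%:R) ^+ k).
have y0 : 0 <= y by rewrite exprn_ge0 // subr_ge0 invf_le1 ?ler1n.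
have y1 : y <= 1.
  by rewrite exprn_ile1 ?subr_ge0 ?invf_le1 ?ler1n // gerBl invr_ge0.
have mE j : `|mean (E j) - y| <= e.
  have := mean_empty [set j] b0; rewrite cards1 div1r => /le_trans; apply.
  rewrite ler_wpM2l // ler_wpM2l // lerXn2r ?nnegrE ?invr_ge0 ?divr_ge0 //.
  by rewrite ler_peMl ?invr_ge0 // ler1n.
have mEE i j : i != j -> mean (fun o => E i o * E j o) <= (1 - 2 / b%:R) ^+ n + e.
  move=> ij; have := mean_empty [set i; j] b0; rewrite cards2 ij ler_norml => /andP[_].
  rewrite lerBlDl => /(le_trans _); apply; apply: ler_mean => o.
  by rewrite /E -natrM mulnb load_set2.
have mEid i : mean (fun o => E i o * E i o) <= y + e.
  rewrite (@eq_mean _ _ _ (E i)) => [|o]; last by rewrite /E -natrM mulnb andbb.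
  by have := mE i; rewrite ler_norml => /andP[_]; lra.
have occE o : #|occupied o|%:R = b%:R - \sum_j E j o :> R.
  have -> : \sum_j E j o = #|~: occupied o|%:R.
    rewrite -sum1_card natr_sum [RHS]big_mkcond /=; apply: eq_bigr => j _.
    by rewrite /E load_set1 inE; case: (_ \notin _).
  have := cardsC (occupied o); rewrite card_ord => /(congr1 (fun m => m%:R : R)).
  by rewrite natrD; lra.
have -> : mean (fun o => (#|occupied o|%:R - b%:R * (1 - y)) ^+ 2) =
   \sum_i \sum_j mean (fun o => E i o * E j o) + (- 2 * (b%:R * y)) * (\sum_j mean (E j))
     + (b%:R * y) ^+ 2.
  under [in RHS]eq_bigr do rewrite -mean_sum.
  rewrite -!mean_sum -meanZ -[(b%:R * y) ^+ 2](mean_cst (T := Om)) // -!meanD.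
  apply: eq_mean => o; rewrite occE.
  under [in RHS]eq_bigr do rewrite -mulr_sumr.
  by rewrite -mulr_suml; ring.
have S2 : \sum_i \sum_j mean (fun o => E i o * E j o) <=
    b%:R * (y + e) + b%:R * (b%:R - 1) * ((1 - 2 / b%:R) ^+ n + e).
  apply: (@le_trans _ _ (\sum_(i < b) ((y + e) + (b%:R - 1) * ((1 - 2 / b%:R) ^+ n + e)))).
    apply: ler_sum => i _; rewrite (bigD1 i) //= lerD //.
    apply: (@le_trans _ _ (\sum_(j < b | j != i) ((1 - 2 / b%:R) ^+ n + e))).
      by apply: ler_sum => j ji; apply: mEE; rewrite eq_sym.
    rewrite sumr_const cardC1 card_ord -[leLHS]mulr_natl.
    by rewrite (_ : b.-1%:R = b%:R - 1 :> R) // -[in RHS](prednK b0) -natr1 addrK.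
  by rewrite sumr_const card_ord -[leLHS]mulr_natl mulrDr mulrA.
have S1 : b%:R * (y - e) <= \sum_j mean (E j).
  apply: (@le_trans _ _ (\sum_(j < b) (y - e))).
    by rewrite sumr_const card_ord mulr_natl.
  by apply: ler_sum => j _; have := mE j; rewrite ler_norml => /andP[+ _]; lra.
have e0 : 0 <= e by rewrite !mulr_ge0 // exprn_ge0 // divr_ge0.
have main := @empty_bins_variance R b n b2; rewrite -/y in main.
have tail := @bin_tail_bound R b n k b0 k6 bk nb.
have S1' := ler_wpM2l (_ : 0 <= 2 * (b%:R * y)) S1.
have {}S1' := S1' ltac:(by rewrite !mulr_ge0).
have ey : e * y <= e by rewrite ler_piMr.
have ey' := ler_wpM2l (_ : 0 <= 2 * b%:R ^+ 2) ey.
have {}ey' := ey' ltac:(by rewrite mulr_ge0 ?sqr_ge0).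
have be : b%:R ^+ 2 * e = 2 * (b%:R ^+ 2 * ('C(n, k)%:R * (2 / b%:R) ^+ k)).
  by rewrite /e mulrCA.
have Q0 : 0 <= n%:R ^+ 2 / b%:R :> R by rewrite divr_ge0 ?sqr_ge0.
(* The constant is 1 for the variance, 9/2 for [b ^ 2 * e] and 9 for the cross term: 29/2 in
   total. *)
apply: (@le_trans _ _ (b%:R * (y + e) + b%:R * (b%:R - 1) * ((1 - 2 / b%:R) ^+ n + e)
   - 2 * (b%:R * y) * (b%:R * (y - e)) + (b%:R * y) ^+ 2)).
  by lra.
set v := (1 - 2 / b%:R) ^+ n in main *.
have -> : b%:R * (y + e) + b%:R * (b%:R - 1) * (v + e)
   - 2 * (b%:R * y) * (b%:R * (y - e)) + (b%:R * y) ^+ 2 =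
   (b%:R * y + b%:R * (b%:R - 1) * v - (b%:R * y) ^+ 2) + b%:R ^+ 2 * e
     + 2 * b%:R ^+ 2 * (e * y) by ring.
by lra.
Qed.

Lemma occupied_concentration (eta : R) : (0 < n)%N -> 0 < eta ->
  (2 <= b)%N -> (6 <= k)%N -> (b <= 2 ^ k)%N -> (3 * n <= 2 * b)%N ->
  mean (fun o => (eta * n%:R < `|#|occupied o|%:R - b%:R * (1 - (1 - b%:R^-1) ^+ n)|)%R%:R)
  <= 15 / (b%:R * eta ^+ 2).
Proof.
move=> n0 eta0 b2 k6 bk nb.
have n_gt0 : 0 < n%:R :> R by rewrite ltr0n.
have b_gt0 : 0 < b%:R :> R by rewrite ltr0n; lia.
have c0 : 0 < (eta * n%:R) ^+ 2 by rewrite exprn_gt0 // mulr_gt0.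
apply: le_trans (markov_mean c0 (fun o => sqr_ge0
   (#|occupied o|%:R - b%:R * (1 - (1 - b%:R^-1) ^+ n))) _) _.
  move=> o lt; rewrite -[leRHS]real_normK ?num_real // lerXn2r ?nnegrE //; last exact: ltW.
  by rewrite mulr_ge0 // ltW.
rewrite ler_pdivrMr // (le_trans (mean_occupied_sq b2 k6 bk nb)) //.
rewrite le_eqVlt; apply/orP; left; apply/eqP; field.
by rewrite !lt0r_neq0.
Qed.

End BallsIntoBins.

(** * Levels and collisions *)


Lemma card_ffun_ord_gt0 k d : (0 < #|{: {ffun 'I_k -> 'I_(2 ^ d)}}|)%N.
Proof. by rewrite card_ffun !card_ord !expn_gt0. Qed.

Lemma geometric_sum_le {R : realType} (X : R) m : 0 <= X ->
  \sum_(r < m | 2 ^+ r <= X) 2 ^+ r <= 2 * X.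
Proof.
move=> X0; rewrite big_mkcond /=; elim: m => [|m IH].
  by rewrite big_ord0 mulr_ge0.
rewrite big_ord_recr /=; case: ifPn => [mX|_]; last by rewrite addr0.
have geo : \sum_(r < m) 2 ^+ r <= 2 ^+ m :> R.
  elim: (m) => [|m' IH']; first by rewrite big_ord0.
  by rewrite big_ord_recr /= exprS mulrDl mul1r lerD.
rewrite mulrDl mul1r lerD // (le_trans _ mX) // (le_trans _ geo) //.
by apply: ler_sum => r _; case: ifP => // _; rewrite exprn_ge0.
Qed.

Section Levels.
Context {R : realType}.
Variables (n d : nat) (P : {poly 'F_2}) (A : {set 'I_n}).
Hypotheses (irrP : irreducible_poly P) (sizeP : size P = d.+1) (nd : (n <= 2 ^ d)%N).
Local Notation seed := {ffun 'I_2 -> 'I_(2 ^ d)}.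

Definition level (f : seed) (a : nat) : nat := tz d (hashval P f a).

Definition above (r : nat) (f : seed) : {set 'I_n} := [set a in A | (r <= level f a)%N].

Lemma mean_level_ge r (a : 'I_n) :
  mean (fun f => (r <= level f a)%N%:R) <= 2 ^- r :> R.
Proof.
have := @mean_prod_hashval d P irrP sizeP R n 2 [set a]
  (fun _ y => (r <= tz d y)%N%:R) nd.
rewrite cards1 => /(_ isT); rewrite big_set1.
under eq_mean do rewrite big_set1.
move=> ->; exact: mean_tz_ge.
Qed.

Lemma mean_level_ge_eq r (a : 'I_n) : (r <= d)%N ->
  mean (fun f => (r <= level f a)%N%:R) = 2 ^- r :> R.
Proof.
move=> rd; have := @mean_prod_hashval d P irrP sizeP R n 2 [set a]
  (fun _ y => (r <= tz d y)%N%:R) nd.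
rewrite cards1 => /(_ isT); rewrite big_set1.
under eq_mean do rewrite big_set1.
by move=> ->; exact: mean_tz_ge_eq.
Qed.

Lemma mean_level_ge2 r (a a' : 'I_n) : a != a' ->
  mean (fun f => (r <= level f a)%N%:R * (r <= level f a')%N%:R) <= 2 ^- r * 2 ^- r :> R.
Proof.
move=> aa'; have := @mean_prod_hashval d P irrP sizeP R n 2 [set a; a']
  (fun _ y => (r <= tz d y)%N%:R) nd.
have aN : a \notin [set a'] by rewrite inE.
rewrite cards2 aa' => /(_ isT); rewrite big_setU1 //= big_set1.
under eq_mean do rewrite big_setU1 //= big_set1.
move=> ->; apply: ler_pM; try exact: mean_tz_ge; by apply: mean_ge0.
Qed.

Lemma card_above r f : #|above r f|%:R = \sum_(a in A) (r <= level f a)%N%:R :> R.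
Proof.
rewrite -sum1_card natr_sum (eq_bigl (fun a => (a \in A) && (r <= level f a)%N)).
  by rewrite big_mkcondr; apply: eq_bigr => a _; case: ifP.
by move=> a; rewrite inE.
Qed.

Lemma mean_above r : mean (fun f => #|above r f|%:R) <= #|A|%:R * 2 ^- r :> R.
Proof.
under eq_mean do rewrite card_above.
rewrite mean_sum mulr_natl -sumr_const; apply: ler_sum => a _.
exact: mean_level_ge.
Qed.

Lemma mean_above_ge1 r : mean (fun f => (0 < #|above r f|)%N%:R) <= #|A|%:R * 2 ^- r :> R.
Proof.
apply: le_trans (mean_above r); apply: ler_mean => f; rewrite ler_nat.
by case: (#|_|).
Qed.

(** Pairwise independence bounds the off-diagonal terms by [mu ^+ 2], leaving a variance of at most
    the mean. For [r <= d] the mean is exact, as the negative cross term requires. *)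
Lemma above_variance r : (r <= d)%N ->
  mean (fun f => (#|above r f|%:R - #|A|%:R * 2 ^- r) ^+ 2) <= #|A|%:R * 2 ^- r :> R.
Proof.
move=> rd; set mu : R := _ * _; pose X a f : R := (r <= level f a)%N%:R.
have -> : mean (fun f => (#|above r f|%:R - mu) ^+ 2) =
    \sum_(a in A) \sum_(a' in A) mean (fun f => X a f * X a' f)
    + (- 2 * mu) * (\sum_(a in A) mean (X a)) + mu ^+ 2.
  under [in RHS]eq_bigr do rewrite -mean_sum.
  rewrite -!mean_sum -meanZ -[mu ^+ 2](mean_cst (T := seed)) ?card_ffun_ord_gt0 // -!meanD.
  apply: eq_mean => f; rewrite card_above.
  under [in RHS]eq_bigr do rewrite -mulr_sumr.
  by rewrite -mulr_suml /X; ring.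
have -> : \sum_(a in A) mean (X a) = mu.
  rewrite /mu mulr_natl -sumr_const; apply: eq_bigr => a _; exact: mean_level_ge_eq.
have : \sum_(a in A) \sum_(a' in A) mean (fun f => X a f * X a' f) <= mu + mu ^+ 2.
  have -> : mu + mu ^+ 2 = \sum_(a in A) (2 ^- r + #|A|%:R * (2 ^- r * 2 ^- r)).
    by rewrite sumr_const -[RHS]mulr_natl /mu; ring.
  apply: ler_sum => a aA; rewrite (bigD1 a) //= lerD //.
    by rewrite (@eq_mean _ _ _ (X a)) ?mean_level_ge // => f; rewrite /X -natrM mulnb andbb.
  apply: (@le_trans _ _ (\sum_(a' in A | a' != a) (2 ^- r * 2 ^- r))).
    by apply: ler_sum => a' /andP[_ ne]; rewrite mean_level_ge2 // eq_sym.
  rewrite mulr_natl -sumr_const [leRHS](bigD1 a) //= lerDr.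
  by rewrite mulr_ge0 // invr_ge0 exprn_ge0.
lra.
Qed.

Lemma above_chebyshev r (eta : R) : (r <= d)%N -> 0 < eta -> (0 < #|A|)%N ->
  mean (fun f => (eta * (#|A|%:R * 2 ^- r) < `|#|above r f|%:R - #|A|%:R * 2 ^- r|)%R%:R)
  <= 2 ^+ r / (eta ^+ 2 * #|A|%:R).
Proof.
move=> rd eta0 A0; have A_gt0 : 0 < #|A|%:R :> R by rewrite ltr0n.
have t0 : 0 < 2 ^+ r :> R by rewrite exprn_gt0.
have mu0 : 0 < #|A|%:R * 2 ^- r :> R by rewrite mulr_gt0 // invr_gt0.
have c0 : 0 < (eta * (#|A|%:R * 2 ^- r)) ^+ 2 by rewrite exprn_gt0 // mulr_gt0.
apply: le_trans (markov_mean c0 (fun f => sqr_ge0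
   (#|above r f|%:R - #|A|%:R * 2 ^- r)) _) _.
  move=> o lt; rewrite -[leRHS]real_normK ?num_real // lerXn2r ?nnegrE //; last exact: ltW.
  by rewrite mulr_ge0 // ltW.
rewrite ler_pdivrMr // (le_trans (above_variance rd)) //.
rewrite le_eqVlt; apply/orP; left; apply/eqP; field.
by rewrite !lt0r_neq0.
Qed.

Definition maxlevel (f : seed) : nat := \max_(a in A) level f a.

(** With [s] = [maxlevel + 9 - lb], the exponent 8 gives [#|A| / 2 ^ s <= b / 2], and 7 gives
    [2 ^ s * b <= 2 ^ 16 * #|A|] when [s > 0]. *)
Definition level_ok (f : seed) : bool :=
  (#|A| <= 2 ^ (maxlevel f + 8))%N && (2 ^ maxlevel f <= 2 ^ 7 * #|A|)%N.

Lemma maxlevel_ge r f : (r <= maxlevel f)%N -> (0 < #|A|)%N -> (0 < #|above r f|)%N.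
Proof.
move=> rM A0; rewrite /maxlevel in rM.
have [a aA e] := eq_bigmax_cond (fun a : 'I_n => level f a) A0.
by apply/card_gt0P; exists a; rewrite inE aA -e.
Qed.

(** Each side costs [2 ^- 7]: a union bound for a maximum that is too high, Chebyshev for one that
    is too low. *)
Lemma level_bad_mean : (0 < #|A|)%N -> mean (fun f => (~~ level_ok f)%:R) <= 2 ^- 6 :> R.
Proof.
move=> A0; have A_gt0 : 0 < #|A|%:R :> R by rewrite ltr0n.
have nA : (#|A| <= n)%N by rewrite (leq_trans (max_card _)) ?card_ord.
have hi : mean (fun f => (2 ^ 7 * #|A| < 2 ^ maxlevel f)%N%:R) <= 2 ^- 7 :> R.
  pose r := (trunc_log 2 (2 ^ 7 * #|A|)).+1.
  have rA : (2 ^ 7 * #|A| < 2 ^ r)%N by apply: trunc_log_ltn.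
  apply: (@le_trans _ _ (mean (fun f => (0 < #|above r f|)%N%:R))).
    apply: ler_mean => f; rewrite ler_nat; case: ltnP => // H.
    rewrite (@maxlevel_ge r) // /r -(ltn_exp2l (m := 2)) // (leq_ltn_trans _ H) //.
    by rewrite trunc_logP // muln_gt0 A0.
  apply: le_trans (mean_above_ge1 r) _.
  rewrite ler_pdivrMr ?exprn_gt0 // mulrC ler_pdivlMr ?exprn_gt0 //.
  by rewrite -!natrX -natrM ler_nat mulnC ltnW.
have lo : mean (fun f => (2 ^ (maxlevel f + 8) < #|A|)%N%:R) <= 2 ^- 7 :> R.
  have [A8|A8] := leqP #|A| (2 ^ 8).
    rewrite (@eq_mean _ _ _ (fun=> 0)) => [|f]; first by rewrite mean_cst ?card_ffun_ord_gt0 // invr_ge0.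
    by rewrite ltnNge (leq_trans A8) // leq_exp2l // leq_addl.
  have A1 : (1 < #|A|)%N by apply: leq_ltn_trans A8; rewrite expn_gt0.
  (* More than [2 ^ 7] elements are expected at this level, yet too low a maximum leaves none
     there. *)
  pose r := (up_log 2 #|A| - 8)%N.
  have up8 : (8 < up_log 2 #|A|)%N.
    by rewrite -(ltn_exp2l (m := 2)) // (leq_trans A8) // up_logP.
  have rA : (2 ^ (r + 7) < #|A|)%N.
    rewrite (_ : (r + 7 = (up_log 2 #|A|).-1)%N); last by rewrite /r; lia.
    by have /andP[] := up_log_bounds (isT : 1 < 2)%N A1.
  have rd : (r <= d)%N.
    rewrite -(leq_exp2l (m := 2)) // (leq_trans _ nd) // (leq_trans _ nA) //.
    by rewrite (leq_trans _ (ltnW rA)) // leq_exp2l // leq_addr.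
  set mu : R := #|A|%:R * 2 ^- r.
  have mu7 : 2 ^+ 7 <= mu.
    rewrite /mu ler_pdivlMr ?exprn_gt0 // -exprD -natrX ler_nat addnC; exact: ltnW.
  have mu0 : 0 < mu by apply: lt_le_trans mu7; rewrite exprn_gt0.
  have c0 : 0 < mu ^+ 2 by rewrite exprn_gt0.
  apply: le_trans (markov_mean c0 (fun f => sqr_ge0 (#|above r f|%:R - mu)) _) _.
    move=> f H; rewrite (_ : #|above r f| = 0%N) ?sub0r ?sqrrN //.
    apply/eqP; rewrite cards_eq0; apply/eqP/setP => a; rewrite !inE.
    apply/negP => /andP[aA ra].
    have aM : (level f a <= maxlevel f)%N by exact: (@leq_bigmax_cond _ (mem A) (fun a : 'I_n => level f a)).
    have : (2 ^ (maxlevel f + 8) < 2 ^ up_log 2 #|A|)%N by rewrite (leq_trans H) // up_logP.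
    by rewrite ltn_exp2l // ltnNge => /negP; apply; rewrite /r in ra; lia.
  rewrite ler_pdivrMr // (le_trans (above_variance rd)) // -/mu.
  by rewrite expr2 mulrA ler_peMl ?(ltW mu0) // -ler_pdivrMl ?invr_gt0 ?exprn_gt0 // invrK mulr1.
rewrite (_ : 2 ^- 6 = 2 ^- 7 + 2 ^- 7 :> R); last by field.
apply: le_trans (lerD lo hi); rewrite -meanD; apply: ler_mean => f.
by rewrite /level_ok negb_and -!ltnNge -natrD ler_nat; case: (_ < _)%N; case: (_ < _)%N.
Qed.

Section Cutoff.
Variables (lb : nat) (eps : R).
Hypotheses (A0 : (0 < #|A|)%N) (eps0 : 0 < eps) (eps1 : eps < 1).
Hypothesis eps_b : 9 * 2 ^+ 23 <= eps ^+ 2 * (2 ^ lb)%:R.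

Lemma lb_ge26 : (26 <= lb)%N.
Proof.
rewrite leqNgt; apply/negP => lb26.
have : (2 ^ lb)%:R <= 2 ^+ 25 :> R by rewrite -natrX ler_nat leq_exp2l.
have e1 : eps ^+ 2 <= 1 by rewrite exprn_ile1 // ltW.
have b0 : 0 <= (2 ^ lb)%:R :> R by [].
have := ler_wpM2r b0 e1; rewrite mul1r.
have -> : 2 ^+ 25 = 4 * 2 ^+ 23 :> R by rewrite -[25%N]/(2 + 23)%N exprD; congr (_ * _); lra.
have : 0 < 2 ^+ 23 :> R by rewrite exprn_gt0.
move: eps_b; set X := 2 ^+ 23; set b := (2 ^ lb)%:R; move: X b => X b; lra.
Qed.

(* Truncated subtraction plays the role of the maximum with 0 in the definition of s_i. *)
Definition cutoff (f : seed) : nat := (maxlevel f + 9 - lb)%N.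

Definition count_ok (f : seed) : bool :=
  `|#|above (cutoff f) f|%:R - #|A|%:R * 2 ^- cutoff f| <= eps / 3 * (#|A|%:R * 2 ^- cutoff f).

(** [cutoff f] is random, so the failure is summed over every fixed [r] with [T r]. The Chebyshev
    bounds grow like [2 ^+ r], and the sum is at most twice its largest admissible term. *)
Lemma count_bad_mean : mean (fun f => (level_ok f && ~~ count_ok f)%:R) <= 2 ^- 6 :> R.
Proof.
have A_gt0 : 0 < #|A|%:R :> R by rewrite ltr0n.
have b_gt0 : 0 < (2 ^ lb)%:R :> R by rewrite ltr0n expn_gt0.
have nA : (#|A| <= n)%N by rewrite (leq_trans (max_card _)) ?card_ord.
pose S := trunc_log 2 #|A|.
pose bad r f := (eps / 3 * (#|A|%:R * 2 ^- r) < `|#|above r f|%:R - #|A|%:R * 2 ^- r|)%R.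
pose T r := (2 ^ r * 2 ^ lb <= 2 ^ 16 * #|A|)%N.
have le1 : mean (fun f => (level_ok f && ~~ count_ok f)%:R) <=
    \sum_(r < S.+1 | T r) mean (fun f => (bad r f)%:R) :> R.
  rewrite -mean_sum; apply: ler_mean => f.
  have [/andP[/andP[_ M7] cN]|_] := boolP (level_ok f && ~~ count_ok f); last exact: sumr_ge0.
  rewrite /count_ok -ltNge in cN.
  (* At cutoff 0 all of [A] is kept and the count is exact. A positive cutoff means that the natural
     subtraction was not truncated. *)
  have s0 : (0 < cutoff f)%N.
    rewrite lt0n; apply: contraL cN => /eqP ->; rewrite -leNgt expr0 invr1 mulr1.
    rewrite (_ : above 0 f = A); last by apply/setP => a; rewrite inE andbT.
    by rewrite subrr normr0 !mulr_ge0 // ltW.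
  have Ts : T (cutoff f).
    rewrite /T -expnD (_ : (cutoff f + lb = 9 + maxlevel f)%N); last by rewrite /cutoff in s0 *; lia.
    by rewrite expnD (_ : 2 ^ 16 = 2 ^ 9 * 2 ^ 7)%N // -mulnA leq_mul2l M7 orbT.
  have sS : (cutoff f < S.+1)%N.
    rewrite ltnS /S trunc_log_max //.
    have h : (2 ^ 16 <= 2 ^ lb)%N by rewrite leq_exp2l // (leq_trans _ lb_ge26).
    rewrite -(leq_pmul2r (_ : 0 < 2 ^ 16)%N) ?expn_gt0 // [(#|A| * _)%N]mulnC.
    by rewrite (leq_trans _ Ts) // leq_mul2l h orbT.
  rewrite (bigD1 (Ordinal sS)) //= {1}/bad cN lerDl.
  exact: sumr_ge0.
apply: (le_trans le1).
have Sd : (S <= d)%N.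
  rewrite -(leq_exp2l (m := 2)) // (leq_trans _ nd) // (leq_trans _ nA) //.
  exact: trunc_logP.
have eta0 : 0 < eps / 3 by rewrite divr_gt0.
have c0 : 0 < (eps / 3) ^+ 2 * #|A|%:R by rewrite mulr_gt0 // exprn_gt0.
apply: (@le_trans _ _ (\sum_(r < S.+1 | T r) 2 ^+ r / ((eps / 3) ^+ 2 * #|A|%:R))).
  apply: ler_sum => r _; apply: above_chebyshev => //.
  by rewrite (leq_trans _ Sd) // -ltnS.
rewrite -mulr_suml ler_pdivrMr //.
pose X : R := 2 ^+ 16 * #|A|%:R / (2 ^ lb)%:R.
have TE r : T r = (2 ^+ r <= X).
  by rewrite ler_pdivlMr // -!natrX -!natrM ler_nat.
under eq_bigl do rewrite TE.
have X0 : 0 <= X by rewrite divr_ge0 ?mulr_ge0 ?exprn_ge0.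
apply: (le_trans (geometric_sum_le _ X0)).
rewrite /X mulrA ler_pdivrMr //.
have -> : 2 ^- 6 * ((eps / 3) ^+ 2 * #|A|%:R) * (2 ^ lb)%:R =
   (2 ^- 6 / 9 * #|A|%:R) * (eps ^+ 2 * (2 ^ lb)%:R) by field.
have -> : 2 * (2 ^+ 16 * #|A|%:R) = (2 ^- 6 / 9 * #|A|%:R) * (9 * 2 ^+ 23) :> R.
  by rewrite -[23%N]/(6 + (1 + 16))%N !exprD; field.
by rewrite ler_wpM2l // mulr_ge0 // divr_ge0 // invr_ge0 exprn_ge0.
Qed.

Lemma cutoff_le_maxlevel f : (cutoff f <= maxlevel f)%N.
Proof. by rewrite leq_subLR addnC leq_add2r (leq_trans _ lb_ge26). Qed.

Lemma level_ok_cutoff f : level_ok f -> (2 * #|A| <= 2 ^ cutoff f * 2 ^ lb)%N.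
Proof.
move=> /andP[A8 _]; rewrite -expnD (@leq_trans (2 ^ (maxlevel f + 9))) //.
  by rewrite -[9%N]/(1 + 8)%N addnCA expnD leq_mul2l A8 orbT.
by rewrite leq_exp2l // [leqRHS]addnC -leq_subLR.
Qed.

Lemma card_above_gt0 f : (0 < #|above (cutoff f) f|)%N.
Proof. by rewrite maxlevel_ge // cutoff_le_maxlevel. Qed.

Lemma card_above_le f : level_ok f -> count_ok f ->
  (3 * #|above (cutoff f) f| <= 2 * 2 ^ lb)%N.
Proof.
move=> lf; rewrite /count_ok ler_norml => /andP[_].
have p0 : 0 < 2 ^+ cutoff f :> R by rewrite exprn_gt0.
have : #|A|%:R * 2 ^- cutoff f <= (2 ^ lb)%:R / 2 :> R.
  rewrite ler_pdivrMr // mulrAC ler_pdivlMr // mulrC [leRHS]mulrC.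
  by rewrite -natrX -!natrM ler_nat level_ok_cutoff.
set mu := _ / _; move=> mub cle.
have mu0 : 0 <= mu by rewrite divr_ge0 // ltW.
have : eps / 3 * mu <= mu / 3.
  by rewrite mulrAC ler_pdivrMr // divfK // ler_piMl // ltW.
rewrite -(ler_nat R) !natrM; move: cle mub; clear.
move: (eps / 3 * mu) (2 ^ lb)%:R (#|above _ _|%:R) => e b N.
by move: (mu) => m; lra.
Qed.

End Cutoff.
End Levels.

Section PairHash.
Context {R : realType}.
Variables (n d c : nat) (P : {poly 'F_2}).
Hypotheses (irrP : irreducible_poly P) (sizeP : size P = d.+1) (nd : (n <= 2 ^ d)%N).
Hypothesis cd : (c <= d)%N.
Local Notation seed := {ffun 'I_2 -> 'I_(2 ^ d)}.

Lemma mean_collision (a a' : 'I_n) : a != a' ->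
  mean (fun g : seed => (hashval P g a %% 2 ^ c == hashval P g a' %% 2 ^ c)%N%:R)
  = 2 ^- c :> R.
Proof.
move=> aa'.
have aN : a \notin [set a'] by rewrite inE.
have m1 (z : 'I_(2 ^ c)) : mean (fun y : 'I_(2 ^ d) => (y %% 2 ^ c == z)%N%:R) = 2 ^- c :> R.
  rewrite (mean_modn (fun y => (y == z)%N%:R)) // /mean card_ord (bigD1 z) //= eqxx.
  rewrite big1 => [|y]; first by rewrite addr0 mul1r natrX.
  by rewrite -val_eqE /= => /negbTE ->.
have -> : mean (fun g : seed => (hashval P g a %% 2 ^ c == hashval P g a' %% 2 ^ c)%N%:R) =
   mean (fun g : seed => \sum_(z < 2 ^ c) (hashval P g a %% 2 ^ c == z)%N%:R
      * (hashval P g a' %% 2 ^ c == z)%N%:R) :> R.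
  apply: eq_mean => g.
  have lt y : (y %% 2 ^ c < 2 ^ c)%N by rewrite ltn_mod expn_gt0.
  rewrite (bigD1 (Ordinal (lt (hashval P g a')))) //= eqxx mulr1 big1 ?addr0 // => z.
  by rewrite -val_eqE /= eq_sym => /negbTE ->; rewrite mulr0.
rewrite mean_sum /=.
rewrite (eq_bigr (fun=> 2 ^- c * 2 ^- c)) => [|z _]; last first.
  have := @mean_prod_hashval d P irrP sizeP R n 2 [set a; a']
    (fun _ y => (y %% 2 ^ c == z)%N%:R) nd.
  rewrite cards2 aa' => /(_ isT); rewrite big_setU1 //= big_set1 m1 => <-.
  by apply: eq_mean => g; rewrite big_setU1 //= big_set1.
rewrite sumr_const card_ord -[LHS]mulr_natl natrX mulrA divff ?mul1r //.
Qed.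

Lemma mean_not_injective (U : {set 'I_n}) :
  mean (fun g : seed => (~~ [forall a in U, forall a' in U,
     (hashval P g a %% 2 ^ c == hashval P g a' %% 2 ^ c)%N ==> (a == a')])%:R)
  <= #|U|%:R ^+ 2 * 2 ^- c :> R.
Proof.
have -> : #|U|%:R ^+ 2 * 2 ^- c = \sum_(a in U) \sum_(a' in U) 2 ^- c :> R.
  rewrite sumr_const sumr_const -[RHS]mulr_natl -[_ *+ _]mulr_natl; ring.
apply: (@le_trans _ _ (\sum_(a in U) \sum_(a' in U | a != a') mean (fun g : seed =>
     (hashval P g a %% 2 ^ c == hashval P g a' %% 2 ^ c)%N%:R))); last first.
  apply: ler_sum => a _; rewrite big_mkcondr; apply: ler_sum => a' _.
  by case: ifP => [/mean_collision ->|_] //; rewrite invr_ge0 exprn_ge0.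
under eq_bigr do rewrite -mean_sum.
rewrite -mean_sum; apply: ler_mean => g.
case: (boolP [forall a in U, _]) => [_|/=].
  by apply: sumr_ge0 => a _; apply: sumr_ge0.
rewrite negb_forall_in => /exists_inP[a aU]; rewrite negb_forall_in => /exists_inP[a' a'U].
rewrite negb_imply => /andP[e ne].
rewrite (bigD1 a) //= (bigD1 a') /= ?a'U ?ne // e -addrA lerDl addr_ge0 //.
  exact: sumr_ge0.
by apply: sumr_ge0 => i _; apply: sumr_ge0.
Qed.

End PairHash.

Definition modO (lb x : nat) : 'I_(2 ^ lb) := Ordinal (ltn_pmod x (expn_gt0 2 lb)).

Lemma mean_prod_modO {R : realType} N d k lb (P : {poly 'F_2}) (S : {set 'I_N})
    (J : {set 'I_(2 ^ lb)}) :
  irreducible_poly P -> size P = d.+1 -> (N <= 2 ^ d)%N -> (lb <= d)%N -> (#|S| <= k)%N ->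
  mean (fun a : {ffun 'I_k -> 'I_(2 ^ d)} => \prod_(x in S) (modO lb (hashval P a x) \in J)%:R)
  = (#|J|%:R / (2 ^ lb)%:R) ^+ #|S| :> R.
Proof.
move=> irrP sizeP Nd lbd Sk.
rewrite (mean_prod_hashval irrP sizeP (fun _ y => (modO lb y \in J)%:R)) // prodr_const.
congr (_ ^+ _).
transitivity (mean (fun y : 'I_(2 ^ d) => (modO lb (y %% 2 ^ lb) \in J)%:R) : R).
  apply: eq_mean => y; congr ((_ \in J)%:R); apply: val_inj => /=.
  by rewrite modn_mod.
rewrite (mean_modn (fun y => (modO lb y \in J)%:R)) // /mean card_ord; congr (_ / _).
rewrite -sum1_card natr_sum [RHS]big_mkcond; apply: eq_bigr => z _.
rewrite (_ : modO lb z = z); last by apply: val_inj; rewrite /= modn_small.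
by case: ifP.
Qed.

(** * Accuracy of a single row *)


Lemma mean_fst {R : realType} {S T : finType} (f : S -> R) : (0 < #|T|)%N ->
  mean (fun p : S * T => f p.1) = mean f.
Proof. by move=> T0; rewrite mean_pair; apply: eq_mean => x /=; exact: mean_cst. Qed.

Lemma ln_dist_le {R : realType} (x y : R) : 1 / 3 <= x -> 1 / 3 <= y ->
  `|ln x - ln y| <= 3 * `|x - y|.
Proof.
have half (u v : R) : 1 / 3 <= u -> 1 / 3 <= v -> ln u - ln v <= 3 * `|u - v|.
  move=> hu hv; have u0 : 0 < u by lra.
  have v0 : 0 < v by lra.
  rewrite -ln_div ?posrE //.
  have -> : u / v = 1 + (u - v) / v by field; exact: lt0r_neq0.
  have lt1 : -1 < (u - v) / v by rewrite ltr_pdivlMr //; lra.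
  rewrite (le_trans (le_ln1Dx lt1)) // ler_pdivrMr // (le_trans (ler_norm _)) //.
  by have := normr_ge0 (u - v); nra.
move=> hx hy; rewrite ler_norml; apply/andP; split; last exact: half.
by have := half y x hy hx; rewrite distrC; lra.
Qed.

Lemma occupancy_inverse {R : realType} (b p N : nat) (eta : R) :
  (2 <= b)%N -> (p <= N)%N -> (3 * N <= 2 * b)%N ->
  `|p%:R - b%:R * (1 - (1 - b%:R^-1) ^+ N)| <= eta * N%:R ->
  `|ln (1 - p%:R / b%:R) / ln (1 - 1 / b%:R) - N%:R| <= 3 * eta * N%:R.
Proof.
move=> b2 pN Nb h.
have b_gt0 : 0 < b%:R :> R by rewrite ltr0n; lia.
have bge2 : 2 <= b%:R :> R by rewrite (ler_nat _ 2 b).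
pose v : R := 1 - b%:R^-1.
have bi : 0 < b%:R^-1 :> R by rewrite invr_gt0.
have bi2 : b%:R^-1 <= 1 / 2 :> R by rewrite div1r lef_pV2 ?posrE.
have v0 : 0 < v by rewrite /v; lra.
have Nb' : N%:R / b%:R <= 2 / 3 :> R.
  rewrite ler_pdivrMr //.
  have : (3 * N)%:R <= (2 * b)%:R :> R by rewrite ler_nat.
  by rewrite !natrM; lra.
have y3 : 1 / 3 <= v ^+ N.
  case: (N) Nb' => [|m] Nb'; first by rewrite expr0; lra.
  have := @powB_le R m 1 v (ltW v0); rewrite !expr1n mulr1 => /(_ ltac:(rewrite /v; lra)).
  by rewrite (_ : 1 - v = b%:R^-1); [lra | rewrite /v; ring].
have x3 : 1 / 3 <= 1 - p%:R / b%:R :> R.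
  have : p%:R / b%:R <= N%:R / b%:R :> R by rewrite ler_wpM2r ?ler_nat // ltW.
  by lra.
have L0 : ln v <= - b%:R^-1 by apply: le_ln1Dx; lra.
have LN0 : ln v != 0 by rewrite lt_eqF //; lra.
have dxy : `|1 - p%:R / b%:R - v ^+ N| <= eta * N%:R / b%:R.
  rewrite ler_pdivlMr // -[X in _ * X](ger0_norm (ltW b_gt0)) -normrM.
  rewrite (_ : _ * b%:R = - (p%:R - b%:R * (1 - v ^+ N))) ?normrN //.
  by field; exact: lt0r_neq0.
have := ln_dist_le x3 y3; rewrite lnXn // -[ln v *+ N]mulr_natr => ld.
rewrite div1r -/v.
have -> : ln (1 - p%:R / b%:R) / ln v - N%:R = (ln (1 - p%:R / b%:R) - ln v * N%:R) / ln v.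
  by field.
rewrite normrM normfV (ler0_norm (_ : ln v <= 0)); last by lra.
rewrite ler_pdivrMr; last by lra.
apply: (le_trans ld).
have e0 : 0 <= eta * N%:R by exact: le_trans h.
apply: (@le_trans _ _ (3 * (eta * N%:R / b%:R))); first by rewrite ler_pM2l.
by rewrite -!mulrA ler_pM2l // mulrA [leRHS]mulrA ler_wpM2l // lerNr.
Qed.

Lemma sqr_le_half {R : realType} (S B : R) :
  0 <= S -> 3 * S <= 2 * B -> S ^+ 2 <= B ^+ 2 / 2.
Proof. by move=> S0 SB; nra. Qed.

Lemma estimate_arith {R : realType} (eps a N d1 d2 : R) : 0 < eps -> eps < 1 -> 0 <= a ->
  d1 <= eps / 4 * N -> `|N - a| <= eps / 3 * a -> d2 <= eps / 3 * a -> d1 + d2 <= eps * a.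
Proof.
move=> e0 e1 a0 h1 /ler_normlP[_ h2] h3.
have h4 : N <= 4 / 3 * a by nra.
by nra.
Qed.

Definition row_estimate {R : realType} (lb : nat) (B : 'I_(2 ^ lb) -> int) (q : nat) : \bar R :=
  let s := Num.max 0
      (let xs := [seq B j + q%:Z | j <- enum 'I_(2 ^ lb)] in
       (\big[Num.max/head 0 xs]_(x <- xs) x) - lb%:Z + 9) in
  let p := #|[set j : 'I_(2 ^ lb) | s <= B j + q%:Z]| in
  if p == (2 ^ lb)%N then +oo%E
  else ((2 : R) ^ s * ln (1 - p%:R / (2 ^ lb)%:R) / ln (1 - 1 / (2 ^ lb)%:R))%:E.

Lemma estimateE {R : realType} (L lb : nat) (B : 'I_L -> 'I_(2 ^ lb) -> int) (q : nat) :
  estimate B q = nth 0%E (sort (fun x y => (x <= y)%E)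
    [seq row_estimate (B i) q | i <- enum 'I_L]) (L %/ 2) :> \bar R.
Proof. by []. Qed.

Section GoodSeeds.
Context {R : realType}.
Variables (n df dg dh k lb : nat) (Pf Pg Ph : {poly 'F_2}) (A : {set 'I_n}) (eps : R).
Hypotheses (irrf : irreducible_poly Pf) (sizef : size Pf = df.+1) (nf : (n <= 2 ^ df)%N).
Hypotheses (irrg : irreducible_poly Pg) (sizeg : size Pg = dg.+1) (ng : (n <= 2 ^ dg)%N).
Hypotheses (irrh : irreducible_poly Ph) (sizeh : size Ph = dh.+1).
Hypotheses (cg : (5 + 2 * lb <= dg)%N) (ch : (5 + 2 * lb <= dh)%N).
Hypotheses (A0 : (0 < #|A|)%N) (eps0 : 0 < eps) (eps1 : eps < 1).
Hypothesis eps_b : 9 * 2 ^+ 23 <= eps ^+ 2 * (2 ^ lb)%:R.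
Hypotheses (k6 : (6 <= k)%N) (lbk : (lb <= k)%N).
Local Notation psiT := (Psi df dg dh k).
Local Notation b := (2 ^ lb)%N.
Local Notation c := (5 + 2 * lb)%N.

Definition selected (f : {ffun 'I_2 -> 'I_(2 ^ df)}) : {set 'I_n} :=
  above Pf A (cutoff Pf A lb f) f.

Definition rehash (g : {ffun 'I_2 -> 'I_(2 ^ dg)}) (a : 'I_n) : 'I_(2 ^ c) :=
  modO c (hashval Pg g a).

Definition bin (h : {ffun 'I_k -> 'I_(2 ^ dh)}) (x : 'I_(2 ^ c)) : 'I_b :=
  modO lb (hashval Ph h x).

Definition injective_ok (g : {ffun 'I_2 -> 'I_(2 ^ dg)}) (U : {set 'I_n}) : bool :=
  [forall a in U, forall a' in U,
    (hashval Pg g a %% 2 ^ c == hashval Pg g a' %% 2 ^ c)%N ==> (a == a')].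

Definition occupied_ok (h : {ffun 'I_k -> 'I_(2 ^ dh)}) (U : {set 'I_(2 ^ c)}) : bool :=
  `|#|occupied bin U h|%:R - b%:R * (1 - (1 - b%:R^-1) ^+ #|U|)| <= eps / 12 * #|U|%:R.

Definition good (psi : psiT) : bool :=
  [&& level_ok Pf A psi.1.1, count_ok Pf A lb eps psi.1.1,
      injective_ok psi.1.2 (selected psi.1.1)
    & occupied_ok psi.2 (rehash psi.1.2 @: selected psi.1.1)].

Lemma rehash_inj g U : injective_ok g U -> {in U &, injective (rehash g)}.
Proof.
move=> /forall_inP H a a' aU a'U [] e.
by apply/eqP; have /forall_inP/(_ a' a'U)/implyP := H a aU; apply; apply/eqP.
Qed.

Lemma good_bound (psi : psiT) : (~~ good psi)%:R <=
  (~~ level_ok Pf A psi.1.1)%:R +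
  (level_ok Pf A psi.1.1 && ~~ count_ok Pf A lb eps psi.1.1)%:R +
  ((level_ok Pf A psi.1.1 && count_ok Pf A lb eps psi.1.1) &&
     ~~ injective_ok psi.1.2 (selected psi.1.1))%:R +
  ([&& level_ok Pf A psi.1.1, count_ok Pf A lb eps psi.1.1 &
     injective_ok psi.1.2 (selected psi.1.1)] &&
     ~~ occupied_ok psi.2 (rehash psi.1.2 @: selected psi.1.1))%:R :> R.
Proof.
rewrite /good; case: level_ok; case: count_ok; case: injective_ok; case: occupied_ok => /=;
  by rewrite ?(addr0, add0r).
Qed.

Let f_gt0 := card_ffun_ord_gt0 2 df.
Let g_gt0 := card_ffun_ord_gt0 2 dg.
Let h_gt0 := card_ffun_ord_gt0 k dh.

Lemma bad_mean : mean (fun psi : psiT => (~~ good psi)%:R) <= 1 / 16 :> R.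
Proof.
apply: le_trans (ler_mean good_bound) _; rewrite !meanD.
have -> : 1 / 16 = 2 ^- 6 + 2 ^- 6 + 2 ^- 6 + 2 ^- 6 :> R by field.
have b_gt0 : 0 < b%:R :> R by rewrite ltr0n expn_gt0.
apply: lerD; [apply: lerD; [apply: lerD|]|].
- rewrite (mean_fst (fun fg => (~~ level_ok Pf A fg.1)%:R)) //.
  rewrite (mean_fst (fun f => (~~ level_ok Pf A f)%:R)) //.
  exact: level_bad_mean.
- rewrite (mean_fst (fun fg => (level_ok Pf A fg.1 && ~~ count_ok Pf A lb eps fg.1)%:R)) //.
  rewrite (mean_fst (fun f => (level_ok Pf A f && ~~ count_ok Pf A lb eps f)%:R)) //.
  exact: count_bad_mean.
- rewrite (mean_fst (fun fg => ((level_ok Pf A fg.1 && count_ok Pf A lb eps fg.1) &&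
     ~~ injective_ok fg.2 (selected fg.1))%:R)) //.
  rewrite mean_pair -[leRHS](mean_cst (T := {ffun 'I_2 -> 'I_(2 ^ df)})) //.
  apply: ler_mean => f /=.
  case: (boolP (level_ok Pf A f && count_ok Pf A lb eps f)) => [/andP[lf cf]|_]; last first.
    by rewrite /= mean_cst // invr_ge0 exprn_ge0.
  rewrite /= (le_trans (mean_not_injective irrg sizeg ng cg _)) //.
  have Ub := card_above_le eps1 lf cf; rewrite -/(selected f) in Ub.
  have {}Ub : 3 * #|selected f|%:R <= 2 * b%:R :> R by rewrite -!natrM ler_nat.
  rewrite ler_pdivrMr ?exprn_gt0 // exprD [(2 * lb)%N]mulnC exprM -[2 ^+ lb]natrX.
  have -> : 2 ^- 6 * (2 ^+ 5 * b%:R ^+ 2) = b%:R ^+ 2 / 2 :> R by field.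
  have S0 : 0 <= #|selected f|%:R :> R by [].
  exact: sqr_le_half.
- rewrite mean_pair -[leRHS](mean_cst
    (T := ({ffun 'I_2 -> 'I_(2 ^ df)} * {ffun 'I_2 -> 'I_(2 ^ dg)})%type)) //; last first.
    by rewrite card_prod muln_gt0 f_gt0.
  apply: ler_mean => -[f g] /=.
  case: (boolP [&& _, _ & _]) => [/and3P[lf cf ig]|_]; last first.
    by rewrite /= mean_cst // invr_ge0 exprn_ge0.
  have cU : #|rehash g @: selected f| = #|selected f| by apply: card_in_imset; exact: rehash_inj.
  have Ub := card_above_le eps1 lf cf; rewrite -/(selected f) -cU in Ub.
  have U0 := card_above_gt0 Pf A0 eps0 eps1 eps_b f; rewrite -/(selected f) -cU in U0.
  have b2 : (2 <= b)%N.
    by rewrite -{1}(expn1 2) leq_exp2l // (leq_trans _ (lb_ge26 eps0 eps1 eps_b)).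
  have bk : (b <= 2 ^ k)%N by rewrite leq_exp2l.
  have eta0 : 0 < eps / 12 by rewrite divr_gt0.
  have ind (S : {set 'I_(2 ^ c)}) (J : {set 'I_b}) : (#|S| <= k)%N ->
      mean (fun h => \prod_(x in S) (bin h x \in J)%:R) = (#|J|%:R / b%:R) ^+ #|S| :> R.
    move=> Sk; apply: mean_prod_modO => //; first by rewrite leq_exp2l.
    by apply: leq_trans ch; lia.
  under eq_mean do rewrite /occupied_ok -ltNge.
  rewrite (le_trans (occupied_concentration h_gt0 ind U0 eta0 b2 k6 bk Ub)) //.
  rewrite ler_pdivrMr; last by rewrite mulr_gt0 ?exprn_gt0.
  have -> : b%:R * (eps / 12) ^+ 2 = (eps ^+ 2 * b%:R) / 144 by field.
  apply: (@le_trans _ _ (2 ^- 6 * (9 * 2 ^+ 23 / 144))); last first.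
    by rewrite ler_wpM2l ?invr_ge0 ?exprn_ge0 // ler_wpM2r.
  have -> : 2 ^- 6 * (9 * 2 ^+ 23 / 144) = 2 ^+ 13 :> R.
    by rewrite -[23%N]/(6 + (4 + 13))%N !exprD; field.
  by rewrite -natrX ler_nat.
Qed.

Lemma pow5E : (2 ^ 5 * b ^ 2 = 2 ^ c)%N.
Proof. by rewrite -expnM -expnD [(lb * 2)%N]mulnC. Qed.

Lemma tau0_geP (psi : psiT) (j : 'I_b) (r : nat) :
  (r%:Z <= tau0 lb Pf Pg Ph A psi j) =
  [exists a in A, (bin psi.2 (rehash psi.1.2 a) == j) && (r <= level Pf psi.1.1 a)%N].
Proof.
have hE (a : 'I_n) : (hH lb Ph psi (gH lb Pg psi a) == j)%N = (bin psi.2 (rehash psi.1.2 a) == j).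
  by rewrite -val_eqE /= /gH pow5E.
apply/bigmax_geP/exists_inP.
- case=> [|[a /andP[aA hj] ra]]; first by case: (r).
  by exists a => //; rewrite -hE hj; rewrite lez_nat in ra.
- case=> a aA /andP[hj ra]; right; exists a; first by rewrite aA hE.
  by rewrite lez_nat.
Qed.

Lemma tau1vD (t : int) (q : nat) : tau1v t q + q%:Z = Num.max t (q%:Z - 1).
Proof. by rewrite /tau1v addr_maxl subrK addrC. Qed.

Lemma tau0_le (psi : psiT) j : tau0 lb Pf Pg Ph A psi j <= (maxlevel Pf A psi.1.1)%:Z.
Proof.
apply: bigmax_le => // a /andP[aA _]; rewrite lez_nat.
exact: (@leq_bigmax_cond _ (mem A) (fun a : 'I_n => level Pf psi.1.1 a)).
Qed.

Lemma row_max (psi : psiT) q : (q <= maxlevel Pf A psi.1.1)%N ->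
  let xs := [seq tau1v (tau0 lb Pf Pg Ph A psi j) q + q%:Z | j : 'I_b <- enum 'I_b] in
  \big[Num.max/head 0 xs]_(x <- xs) x = (maxlevel Pf A psi.1.1)%:Z.
Proof.
move=> qM /=; set xs := map _ _; set M := maxlevel Pf A psi.1.1.
have xsM x : x \in xs -> x <= M%:Z.
  move=> /mapP[j _ ->]; rewrite tau1vD ge_max tau0_le /=.
  by move: qM; rewrite -/M; clear; lia.
have xs0 : xs != [::].
  by rewrite -size_eq0 size_map size_enum_ord expn_eq0.
apply/le_anti/andP; split.
  rewrite big_seq; apply: bigmax_le => // .
  by apply: xsM; case: (xs) xs0 => // x xs' _; exact: mem_head.
have [a aA e] := eq_bigmax_cond (fun a : 'I_n => level Pf psi.1.1 a) A0.
set j := bin psi.2 (rehash psi.1.2 a).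
have tj : M%:Z <= tau0 lb Pf Pg Ph A psi j.
  by rewrite tau0_geP; apply/exists_inP; exists a => //; rewrite eqxx /M /maxlevel e /=.
apply: (le_trans tj).
apply: (@le_trans _ _ (tau1v (tau0 lb Pf Pg Ph A psi j) q + q%:Z)).
  by rewrite tau1vD le_max lexx.
set xj := _ + _; have xjs : xj \in xs by apply/mapP; exists j; rewrite ?mem_enum.
exact: (@le_bigmax_seq _ _ _ xs (head 0 xs) xj predT id).
Qed.

Lemma row_count (psi : psiT) q s : (q <= s)%N -> s = cutoff Pf A lb psi.1.1 ->
  #|[set j : 'I_b | s%:Z <= tau1v (tau0 lb Pf Pg Ph A psi j) q + q%:Z]| =
  #|occupied bin (rehash psi.1.2 @: selected psi.1.1) psi.2|.
Proof.
move=> qs sE; apply: eq_card => j; rewrite inE tau1vD le_max.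
have -> : (s%:Z <= q%:Z - 1) = false by apply/negbTE; lia.
rewrite orbF tau0_geP /occupied -imset_comp.
apply/exists_inP/imsetP => [[a aA /andP[/eqP hj sa]]|[a aS ->]].
  by exists a => //; rewrite /selected inE aA -sE.
by move: aS; rewrite /selected inE -sE => /andP[aA sa]; exists a => //; rewrite eqxx.
Qed.

Lemma good_row_estimate (psi : psiT) q : good psi -> (q <= cutoff Pf A lb psi.1.1)%N ->
  exists2 y : R,
    row_estimate (lb := lb) (fun j => tau1v (tau0 lb Pf Pg Ph A psi j) q) q = y%:E :> \bar R &
    `|y - #|A|%:R| <= eps * #|A|%:R.
Proof.
move=> /and4P[lf cf ig oh] qs.
set s := cutoff Pf A lb psi.1.1 in qs.
have sM : (s <= maxlevel Pf A psi.1.1)%N := cutoff_le_maxlevel Pf A eps0 eps1 eps_b _.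
have lb26 := lb_ge26 eps0 eps1 eps_b.
rewrite /row_estimate row_max; last exact: leq_trans qs sM.
have -> : Num.max 0 ((maxlevel Pf A psi.1.1)%:Z - lb%:Z + 9) = s%:Z.
  by rewrite /s /cutoff; move: (maxlevel _ _ _) => M; clear; lia.
rewrite (row_count qs) //.
set U := rehash psi.1.2 @: selected psi.1.1 in oh *.
have cU : #|U| = #|selected psi.1.1| by apply: card_in_imset; exact: rehash_inj.
have Ub := card_above_le eps1 lf cf; rewrite -/(selected psi.1.1) -cU in Ub.
set p := #|occupied bin U psi.2|.
have pU : (p <= #|U|)%N by exact: leq_imset_card.
have b0 : (0 < b)%N by rewrite expn_gt0.
have pb : (p < b)%N by lia.
have b2 : (2 <= b)%N by rewrite -{1}(expn1 2) leq_exp2l // (leq_trans _ lb26).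
rewrite (ltn_eqF pb); eexists; first by [].
have inv := occupancy_inverse b2 pU Ub oh.
rewrite -mulrA -[2 ^ s%:Z]/(2 ^+ s).
move: inv; set Lq := ln _ / ln _ => inv.
have p0 : 0 < 2 ^+ s :> R by rewrite exprn_gt0.
move: cf; rewrite /count_ok -/s -/(selected psi.1.1) -cU.
set N : R := #|U|%:R in inv *; set a : R := #|A|%:R; set t : R := 2 ^+ s in p0 * => cf.
have a0 : 0 <= a by [].
have N0 : 0 <= N by [].
have cf' : `|t * N - a| <= eps / 3 * a.
  have -> : t * N - a = (N - a / t) * t by field; exact: lt0r_neq0.
  rewrite normrM (ger0_norm (ltW p0)).
  have -> : eps / 3 * a = eps / 3 * (a / t) * t by field; exact: lt0r_neq0.
  by rewrite ler_pM2r.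
have inv' : `|t * Lq - t * N| <= eps / 4 * (t * N).
  rewrite -mulrBr normrM (ger0_norm (ltW p0)).
  have -> : eps / 4 * (t * N) = t * (3 * (eps / 12) * N) by field.
  by rewrite ler_pM2l.
rewrite (le_trans (ler_distD (t * N) _ _)) //.
exact: (estimate_arith eps0 eps1 a0 inv' cf' cf').
Qed.

End GoodSeeds.

(** * Deviation bounds and the size of the table *)


Lemma pow2_telescope {R : realType} (l u : nat) : (u <= l)%N ->
  2 ^+ u.+1 = 2 + \sum_(x < l) (x < u)%N%:R * 2 ^+ x.+1 :> R.
Proof.
elim: l u => [|l IH] u.
  by rewrite leqn0 => /eqP ->; rewrite big_ord0 addr0 expr1.
rewrite leq_eqVlt big_ord_recr /= => /orP[/eqP ->|]; last first.
  by rewrite ltnS => ul; rewrite ltnNge ul mul0r addr0; exact: IH.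
rewrite ltnSn mul1r addrA [2 ^+ l.+2]exprS mulr2n mulrDl mul1r; congr (_ + _).
rewrite (IH l (leqnn l)); congr (_ + _); apply: eq_bigr => x _.
by rewrite !ltn_ord ltnS ltnW.
Qed.

Lemma geometric_inv_le {R : realType} (r : R) (J : nat) : 2 <= r ->
  \sum_(m < J) r ^- m <= r / (r - 1).
Proof.
move=> r2; have r0 : 0 < r by lra.
have -> : \sum_(m < J) r ^- m = r / (r - 1) * (1 - r ^- J).
  elim: J => [|J IH]; first by rewrite big_ord0 expr0 invr1 subrr mulr0.
  rewrite big_ord_recr /= IH exprS; field.
  by rewrite expf_neq0 ?lt0r_neq0 //; lra.
rewrite ler_piMr //; first by rewrite divr_ge0 //; lra.
by rewrite gerBl invr_ge0 exprn_ge0 // ltW.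
Qed.

Section WalkTail.
Context {R : realType} {V : finType}.
Variables (a : V -> V -> nat) (D l b : nat) (lam : R) (bad : pred V) (F : V -> nat).
Hypotheses (D0 : (0 < D)%N) (l3 : (3 <= l)%N) (b0 : (0 < b)%N).
Hypotheses (lam0 : 0 <= lam) (lam16 : lam <= 1 / 16) (lam_l : lam * 2 ^+ l <= 1).
Hypothesis exp_a : expander a D lam.
Hypothesis bad16 : mean (fun v => (bad v)%:R) <= 1 / 16 :> R.
Hypothesis F_tail : forall x : nat, mean (fun v => (x.+1 * b <= F v)%N%:R) <= 8 / 16 ^+ x :> R.
Hypothesis V0 : (0 < #|V|)%N.

Let lam1 : lam < 1. Proof. by move: lam16; lra. Qed.

Definition bad_weight (v : V) : R := if bad v then 16 else 1.
(* Capped at l, so that [lam * max load_weight] stays bounded. *)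
Definition trunc_load (v : V) : nat := minn (F v %/ b) l.
Definition load_weight (v : V) : R := 2 ^+ (trunc_load v).+1.
Definition overflow (v : V) : R := (l.+1 * b <= F v)%N%:R.

Lemma bad_weight_walk :
  \sum_(w : l.-tuple V) walk_weight a D w * (\prod_(v <- w) bad_weight v) <= (47 / 16) ^+ l.
Proof.
have W0 v : 0 <= bad_weight v by rewrite /bad_weight; case: ifP.
have W16 v : bad_weight v <= 16 by rewrite /bad_weight; case: ifP => _; lra.
have mW : mean bad_weight <= 31 / 16.
  rewrite (@eq_mean _ _ _ (fun v => 1 + 15 * (bad v)%:R)) => [|v]; last first.
    by rewrite /bad_weight; case: (bad v) => /=; lra.
  by rewrite meanD meanZ mean_cst //; move: bad16; lra.
have m0 : 0 <= mean bad_weight by exact: mean_ge0.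
have l0 : (0 < l)%N by apply: leq_trans l3.
rewrite (le_trans (walk_mgf D0 lam0 lam1 exp_a l0 _ W0 W16)) //.
rewrite lerXn2r ?nnegrE //; first by rewrite addr_ge0 // mulr_ge0.
by move: mW lam16; lra.
Qed.

Lemma mean_load_weight : mean load_weight <= 21.
Proof.
rewrite (@eq_mean _ _ _ (fun v => 2 + \sum_(x < l) 2 ^+ x.+1 * (x < trunc_load v)%N%:R)).
  rewrite meanD mean_cst // mean_sum.
  apply: (@le_trans _ _ (2 + 16 * \sum_(x < l) 8 ^- x)); last first.
    have := @geometric_inv_le R 8 l; set S := \sum_(_ < _) _ => h.
    have {}h : S <= 8 / 7 by rewrite (_ : 8 / 7 = 8 / (8 - 1) :> R); [apply: h; lra | field].
    by lra.
  rewrite lerD2l mulr_sumr; apply: ler_sum => x _; rewrite meanZ.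
  have le1 : mean (fun v => (x < trunc_load v)%N%:R) <= 8 / 16 ^+ x :> R.
    apply: le_trans (F_tail x); apply: ler_mean => v; rewrite ler_nat.
    case: ltnP => // H; rewrite lt0b -leq_divRL //.
    by rewrite (leq_trans H) // geq_minl.
  have p0 : 0 <= 2 ^+ x.+1 :> R by rewrite exprn_ge0.
  apply: (le_trans (ler_wpM2l p0 le1)).
  have -> : 16 = 2 * 8 :> R by lra.
  rewrite exprMn exprS le_eqVlt; apply/orP; left; apply/eqP; field.
  by rewrite !expf_neq0.
move=> v; rewrite /load_weight (@pow2_telescope _ l) ?geq_minr //; congr (_ + _).
by apply: eq_bigr => x _; rewrite mulrC.
Qed.

Lemma load_weight_walk :
  \sum_(w : l.-tuple V) walk_weight a D w * (\prod_(v <- w) load_weight v) <= 23 ^+ l.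
Proof.
have W0 v : 0 <= load_weight v by rewrite exprn_ge0.
have WK v : load_weight v <= 2 ^+ l.+1.
  by rewrite ler_weXn2l ?ler1n // ltnS geq_minr.
have l0 : (0 < l)%N by apply: leq_trans l3.
have K0 : 0 <= 2 ^+ l.+1 :> R by rewrite exprn_ge0.
rewrite (le_trans (walk_mgf D0 lam0 lam1 exp_a l0 K0 W0 WK)) //.
have m0 : 0 <= mean load_weight by exact: mean_ge0.
rewrite lerXn2r ?nnegrE //; first by rewrite addr_ge0 // mulr_ge0.
have := mean_load_weight; rewrite exprS; move: lam_l; nra.
Qed.

Lemma overflow_walk :
  \sum_(w : l.-tuple V) walk_weight a D w * (\sum_(v <- w) overflow v) <= l%:R * (8 / 16 ^+ l).
Proof.
by rewrite (walk_mean_sum D0 exp_a) ler_wpM2l //; exact: F_tail.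
Qed.

Lemma walk_weight_ge0 L (w : L.-tuple V) : 0 <= walk_weight a D w :> R.
Proof.
rewrite mulr_ge0 ?invr_ge0 // prodr_ge0 // => uv _; exact: divr_ge0.
Qed.

Lemma prod_bad_weight (w : seq V) : \prod_(v <- w) bad_weight v = 16 ^+ count bad w.
Proof.
elim: w => [|v w IH]; first by rewrite big_nil.
by rewrite big_cons IH /bad_weight /=; case: ifP => _; rewrite ?mul1r ?exprS.
Qed.

Lemma load_overflow (w : seq V) : (33 * b * l < \sum_(v <- w) F v)%N ->
  1 <= (\prod_(v <- w) load_weight v) / 2 ^+ (33 * l) + \sum_(v <- w) overflow v.
Proof.
move=> H; have [/hasP[v vw ov]|/hasPn no] := boolP (has (fun v => l.+1 * b <= F v)%N w).
  have P0 : 0 <= (\prod_(v <- w) load_weight v) / 2 ^+ (33 * l) :> R.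
    by rewrite divr_ge0 ?exprn_ge0 // prodr_ge0 // => u _; rewrite exprn_ge0.
  apply: ler_wpDl => //; rewrite (big_rem v) //= {1}/overflow ov lerDl.
  exact: sumr_ge0.
rewrite ler_wpDr //; first exact: sumr_ge0.
rewrite ler_pdivlMr ?exprn_gt0 // mul1r.
have -> : \prod_(v <- w) load_weight v = 2 ^+ (\sum_(v <- w) (F v %/ b).+1).
  rewrite -prodrXr big_seq [RHS]big_seq; apply: eq_bigr => v vw.
  rewrite /load_weight /trunc_load; congr (2 ^+ _.+1); apply/minn_idPl.
  by have := no v vw; rewrite -ltnNge -ltn_divLR // ltnS.
rewrite ler_eXn2l ?ltr1n //.
rewrite -(leq_pmul2l b0) mulnCA mulnA (leq_trans (ltnW H)) //.
rewrite big_distrr /=; apply: leq_sum => v _.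
by rewrite mulnC; apply/ltnW/ltn_ceil.
Qed.

Lemma walk_tail (E : pred (l.-tuple V)) :
  (forall w, E w -> (l <= 2 * count bad w)%N \/ (33 * b * l < \sum_(v <- w) F v)%N) ->
  walk_prob a D E <= 2 * (3 / 4) ^+ l :> R.
Proof.
move=> HE.
have c4 : 0 < 4 ^+ l :> R by rewrite exprn_gt0.
have c33 : 0 < 2 ^+ (33 * l) :> R by rewrite exprn_gt0.
pose G (w : l.-tuple V) : R := (\prod_(v <- w) bad_weight v) / 4 ^+ l +
  ((\prod_(v <- w) load_weight v) / 2 ^+ (33 * l) + \sum_(v <- w) overflow v).
have BW0 (w : seq V) : 0 <= \prod_(v <- w) bad_weight v / 4 ^+ l :> R.
  by rewrite divr_ge0 // ?exprn_ge0 // prodr_ge0 // => v _; rewrite /bad_weight; case: ifP.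
have LW0 (w : seq V) : 0 <= \prod_(v <- w) load_weight v / 2 ^+ (33 * l) :> R.
  by rewrite divr_ge0 // ?exprn_ge0 // prodr_ge0 // => v _; rewrite exprn_ge0.
have OV0 (w : seq V) : 0 <= \sum_(v <- w) overflow v by exact: sumr_ge0.
have G0 w : 0 <= G w by rewrite !addr_ge0.
have EG w : E w -> 1 <= G w.
  move=> /HE[lw|lw].
    apply: ler_wpDr; first by rewrite addr_ge0.
    rewrite ler_pdivlMr // mul1r prod_bad_weight.
    have -> : 16 = 4 ^+ 2 :> R by lra.
    by rewrite -exprM ler_eXn2l // ltr1n.
  by apply: ler_wpDl => //; exact: load_overflow.
apply: (@le_trans _ _ (\sum_(w : l.-tuple V) walk_weight a D w * G w)).
  rewrite /walk_prob big_mkcond /=; apply: ler_sum => w _.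
  case: ifP => [/EG g1|_]; last by rewrite mulr_ge0 // walk_weight_ge0.
  by rewrite ler_peMr // walk_weight_ge0.
rewrite (eq_bigr (fun w : l.-tuple V =>
   walk_weight a D w * (\prod_(v <- w) bad_weight v) / 4 ^+ l +
   (walk_weight a D w * (\prod_(v <- w) load_weight v) / 2 ^+ (33 * l) +
    walk_weight a D w * (\sum_(v <- w) overflow v)))) => [|w _]; last by rewrite /G; ring.
rewrite !big_split /= -!mulr_suml.
have h1 : (\sum_(w : l.-tuple V) walk_weight a D w * (\prod_(v <- w) bad_weight v)) / 4 ^+ l
    <= (3 / 4) ^+ l.
  rewrite ler_pdivrMr // (le_trans bad_weight_walk) // -exprMn.
  by rewrite lerXn2r ?nnegrE //; lra.
have h2 : (\sum_(w : l.-tuple V) walk_weight a D w * (\prod_(v <- w) load_weight v)) / 2 ^+ (33 * l)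
    <= (1 / 4) ^+ l.
  rewrite ler_pdivrMr // (le_trans load_weight_walk) // exprM -exprMn.
  rewrite lerXn2r ?nnegrE // (_ : 33 = 26 + 7)%N // exprD mulrA.
  have : 1 <= 2 ^+ 26 :> R by rewrite exprn_ege1 // ler1n.
  by move: (2 ^+ 26) => z; lra.
have h3 := overflow_walk.
have h4 : l%:R * (8 / 16 ^+ l) <= (1 / 4) ^+ l :> R.
  have -> : 16 ^+ l = 4 ^+ l * (2 ^+ l * 2 ^+ l) :> R.
    by rewrite -!exprMn; congr (_ ^+ _); lra.
  have p2 : 0 < 2 ^+ l :> R by rewrite exprn_gt0.
  rewrite expr_div_n expr1n div1r invfM mulrA mulrCA ler_piMr ?invr_ge0 ?exprn_ge0 //.
  rewrite ler_pdivrMr ?mulr_gt0 // mul1r; apply: ler_pM => //.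
    by rewrite -natrX ler_nat ltnW // ltn_expl.
  by rewrite (_ : 8 = 2 ^+ 3); [rewrite ler_eXn2l // ltr1n | lra].
have h5 : (1 / 4) ^+ l + (1 / 4) ^+ l <= (3 / 4) ^+ l :> R.
  rewrite -(prednK (_ : 0 < l)%N) ?(leq_trans _ l3) // !exprS.
  have : (1 / 4) ^+ l.-1 <= (3 / 4) ^+ l.-1 :> R by rewrite lerXn2r ?nnegrE //; lra.
  have : 0 <= (1 / 4) ^+ l.-1 :> R by rewrite exprn_ge0.
  by move: ((1 / 4) ^+ l.-1) ((3 / 4) ^+ l.-1) => u v; lra.
move: h1 h2 h3 h4 h5; move: (_ / 4 ^+ l) (_ / 2 ^+ (33 * l)) => x1 x2.
move: (l%:R * _) ((1 / 4) ^+ l) ((3 / 4) ^+ l) (\sum_(i : l.-tuple V) _ * _) => y1 y2 y3 y4.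
lra.
Qed.

End WalkTail.

Lemma median_between {R : realType} (s : seq (\bar R)) (lo hi : \bar R) :
  (2 * count (fun y => ~~ ((lo <= y)%E && (y <= hi)%E)) s < size s)%N ->
  (lo <= nth 0%E (sort (fun x y => (x <= y)%E) s) (size s %/ 2))%E &&
  (nth 0%E (sort (fun x y => (x <= y)%E) s) (size s %/ 2) <= hi)%E.
Proof.
set le := (fun x y : \bar R => (x <= y)%E); set out := (fun y : \bar R => ~~ _).
set t := sort le s => H.
have st : size t = size s by rewrite size_sort.
have ct : count out t = count out s by apply/permP; rewrite perm_sort.
have tot : total le by move=> x y; exact: le_total.
have tr : transitive le by move=> x y z; exact: le_trans.
have srt : sorted le t by exact: sort_sorted.
set m := (size s %/ 2)%N.
have mL : (m < size t)%N by rewrite st ltn_Pdiv // (leq_ltn_trans _ H).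
have ds : (size (drop m t) = size s - m)%N by rewrite size_drop st.
have ts : (size (take m.+1 t) = m.+1)%N by rewrite size_takel.
have md : (2 * m <= size s < 2 * m + 2)%N.
  by rewrite /m; have := divn_eq (size s) 2; have := ltn_pmod (size s) (isT : 0 < 2)%N; lia.
apply/andP; split; rewrite leNgt; apply/negP => bad_m.
  have : all out (take m.+1 t).
    apply/(all_nthP 0%E) => i; rewrite ts ltnS => im.
    rewrite nth_take ?ltnS // /out negb_and -!ltNge; apply/orP; left.
    apply: le_lt_trans bad_m; apply: (sorted_leq_nth tr _ 0%E srt) => //.
    by rewrite inE (leq_ltn_trans im).
  rewrite all_count ts => /eqP c1.
  have : (m.+1 <= count out s)%N by rewrite -ct -(cat_take_drop m.+1 t) count_cat c1 leq_addr.
  by move: (count out s) (m) H md => c' m' H' md'; lia.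
have : all out (drop m t).
  apply/(all_nthP 0%E) => i; rewrite ds => im.
  rewrite nth_drop /out negb_and -!ltNge; apply/orP; right.
  apply: lt_le_trans bad_m _; apply: (sorted_leq_nth tr _ 0%E srt) => //.
  - by rewrite inE st; lia.
  - exact: leq_addr.
rewrite all_count ds => /eqP c1.
have : (size s - m <= count out s)%N by rewrite -ct -(cat_take_drop m t) count_cat c1 leq_addl.
by move: (count out s) (m) H md => c' m' H' md'; lia.
Qed.

Lemma mul4_le_pow2 m : (4 * m <= 2 ^ m.+1)%N.
Proof. by elim: m => // -[|[|m]] // IH; rewrite expnS; lia. Qed.

Section Overflow.
Context {R : realType}.
Variables (n df dg dh k lb : nat) (Pf Pg Ph : {poly 'F_2}) (A : {set 'I_n}) (q : nat).
Hypotheses (irrf : irreducible_poly Pf) (sizef : size Pf = df.+1) (nf : (n <= 2 ^ df)%N).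
Hypothesis Aq : (#|A| <= 2 ^ q * 2 ^ lb)%N.
Local Notation psiT := (Psi df dg dh k).
Local Notation b := (2 ^ lb)%N.

Definition cell_bits (psi : psiT) (j : 'I_b) : nat :=
  trunc_log 2 (absz (tau1v (tau0 lb Pf Pg Ph A psi j) q + 2)%R).

Definition row_bits (psi : psiT) : nat := (\sum_(j < b) cell_bits psi j)%N.

Let K := (\max_(psi : psiT) maxlevel Pf A psi.1.1 + 3)%N.

Lemma cell_bits_le (psi : psiT) j x :
  (cell_bits psi j <= x + \sum_(x <= m < K) (m < cell_bits psi j))%N.
Proof.
set t := cell_bits psi j.
have tK : (t <= K)%N.
  have y0 : (0 < absz (tau1v (tau0 lb Pf Pg Ph A psi j) q + 2)%R)%N.
    by rewrite /tau1v; lia.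
  have := trunc_logP (isT : 1 < 2)%N y0; rewrite -/(cell_bits psi j) -/t => h1.
  have h2 := ltn_expl t (isT : 1 < 2)%N.
  have h3 := @tau0_le n df dg dh k lb Pf Pg Ph A psi j.
  have h4 : (maxlevel Pf A psi.1.1 <= \max_(psi : psiT) maxlevel Pf A psi.1.1)%N.
    exact: (leq_bigmax (F := fun psi : psiT => maxlevel Pf A psi.1.1)).
  by rewrite /K; move: h1 h3; rewrite /tau1v; lia.
have [xt|tx] := leqP x t; last by rewrite (leq_trans (ltnW tx)) ?leq_addr.
rewrite (big_cat_nat xt tK) /= (eq_big_nat _ _ (F2 := fun=> 1%N)) => [|m /andP[_ ->]] //.
by rewrite sum_nat_const_nat muln1 addnA subnKC // leq_addr.
Qed.

Lemma cell_bits_gtP (psi : psiT) j m : (m < cell_bits psi j)%N ->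
  [exists a in A, (bin Ph psi.2 (rehash lb Pg psi.1.2 a) == j) &&
     (q + (2 ^ m.+1 - 2) <= level Pf psi.1.1 a)%N].
Proof.
move=> mt; rewrite -tau0_geP.
have y0 : (0 < absz (tau1v (tau0 lb Pf Pg Ph A psi j) q + 2)%R)%N.
  by rewrite /tau1v; lia.
have h1 := trunc_logP (isT : 1 < 2)%N y0; rewrite -/(cell_bits psi j) in h1.
have h2 : (2 ^ m.+1 <= 2 ^ cell_bits psi j)%N by rewrite leq_exp2l.
have h3 : (2 <= 2 ^ m.+1)%N by rewrite -{1}(expn1 2) leq_exp2l.
have := leq_trans h2 h1; rewrite /tau1v; move: (2 ^ m.+1)%N h3 (tau0 _ _ _ _ _ _ _) => z; lia.
Qed.

Lemma count_cells_le (psi : psiT) m :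
  (\sum_(j < b) (m < cell_bits psi j) <= #|above Pf A (q + (2 ^ m.+1 - 2)) psi.1.1|)%N.
Proof.
set U := above _ _ _ _.
apply: (@leq_trans #|(fun a => bin Ph psi.2 (rehash lb Pg psi.1.2 a)) @: U|); last exact: leq_imset_card.
rewrite -sum1_card [leqRHS]big_mkcond /=; apply: leq_sum => j _.
case: (boolP (m < cell_bits psi j)%N) => // /cell_bits_gtP/exists_inP[a aA /andP[/eqP hj la]].
by rewrite (_ : j \in _) //; apply/imsetP; exists a; rewrite // inE aA.
Qed.

Lemma row_bits_le (psi : psiT) x :
  (row_bits psi <= x * b + \sum_(x <= m < K) #|above Pf A (q + (2 ^ m.+1 - 2)) psi.1.1|)%N.
Proof.
apply: (@leq_trans (\sum_(j < b) (x + \sum_(x <= m < K) (m < cell_bits psi j)))%N).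
  by apply: leq_sum => j _; exact: cell_bits_le.
rewrite big_split /= sum_nat_const card_ord mulnC leq_add2l exchange_big /=.
by apply: leq_sum => m _; exact: count_cells_le.
Qed.

Lemma row_bits_tail x :
  mean (fun psi : psiT => (x.+1 * b <= row_bits psi)%N%:R) <= 8 / 16 ^+ x :> R.
Proof.
have b0 : 0 < b%:R :> R by rewrite ltr0n expn_gt0.
pose N m (psi : psiT) : R := #|above Pf A (q + (2 ^ m.+1 - 2)) psi.1.1|%:R.
apply: (le_trans (@markov_mean R _ _ (fun psi => \sum_(x <= m < K) N m psi) b%:R b0 _ _)).
- by move=> psi; apply: sumr_ge0.
- move=> psi H; rewrite -natr_sum ler_nat -(leq_add2l (x * b)) -mulSnr.
  exact: leq_trans H (row_bits_le psi x).
rewrite mean_sum ler_pdivrMr //.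
have mN m : mean (N m) <= 4 / 16 ^+ m * b%:R.
  rewrite (mean_fst (fun fg : _ * _ => #|above Pf A (q + (2 ^ m.+1 - 2)) fg.1|%:R : R)) ?card_ffun_ord_gt0 //.
  rewrite (mean_fst (fun f => #|above Pf A (q + (2 ^ m.+1 - 2)) f|%:R : R)) ?card_ffun_ord_gt0 //.
  apply: (le_trans (mean_above A irrf sizef nf _)).
  rewrite ler_pdivrMr ?exprn_gt0 // exprD.
  have h3 : (2 <= 2 ^ m.+1)%N by rewrite -{1}(expn1 2) leq_exp2l.
  have e1 : 2 ^+ (2 ^ m.+1 - 2) * 4 = 2 ^+ (2 ^ m.+1) :> R.
    by rewrite -[in RHS](subnK h3) exprD; congr (_ * _); lra.
  have -> : 4 / 16 ^+ m * b%:R * (2 ^+ q * 2 ^+ (2 ^ m.+1 - 2)) =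
     (2 ^+ q * b%:R) * (2 ^+ (2 ^ m.+1) / 16 ^+ m) :> R by rewrite -e1; ring.
  apply: (@le_trans _ _ (2 ^+ q * b%:R)).
    by rewrite -natrX -natrM ler_nat.
  rewrite ler_peMr ?mulr_ge0 ?exprn_ge0 // ler_pdivlMr ?exprn_gt0 // mul1r.
  rewrite (_ : 16 = 2 ^+ 4); last by lra.
  by rewrite -exprM ler_weXn2l ?ler1n // mul4_le_pow2.
apply: (@le_trans _ _ (\sum_(x <= m < K) 4 / 16 ^+ m * b%:R)); first by apply: ler_sum => m _.
rewrite -mulr_suml ler_wpM2r // -mulr_sumr.
rewrite -{1}[x]add0n big_addn big_mkord.
under eq_bigr do rewrite exprD invfM.
rewrite -mulr_suml mulrA ler_wpM2r ?invr_ge0 ?exprn_ge0 //.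
have := @geometric_inv_le R 16 (K - x); set S := \sum_(_ < _) _ => h.
have {}h : S <= 16 / 15 by rewrite (_ : 16 / 15 = 16 / (16 - 1) :> R); [apply: h; lra | field].
by lra.
Qed.

End Overflow.

(** * Numerical bounds on l, lambda, b and k *)


Section ParamBounds.
Context {R : realType}.

Lemma absz_ceil_ge (x : R) : x <= (absz (Num.ceil x))%:R.
Proof. by rewrite natr_absz (le_trans (ceil_ge x)) // ler_int ler_norm. Qed.

Lemma ln2_ge : 1 / 2 <= ln 2 :> R.
Proof.
have : ln (1 + - (1 / 2)) <= - (1 / 2) :> R by apply: le_ln1Dx; lra.
have -> : 1 + - (1 / 2) = 2^-1 :> R by lra.
by rewrite lnV ?posrE //; lra.
Qed.

Lemma ln3_ge1 : 1 <= ln 3 :> R.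
Proof.
have h : (7 / 8) ^+ 8 <= expR (- 1 / 8) ^+ 8 :> R.
  by rewrite lerXn2r ?nnegrE ?expR_ge0 ?(le_trans _ (expR_ge1Dx _)) //; lra.
have : 3^-1 <= expR (- 1) :> R.
  rewrite (_ : - 1 = 8%:R * (- 1 / 8)) ?expRM_natl; last by lra.
  by apply: le_trans h; lra.
by rewrite -ler_ln ?posrE ?invr_gt0 ?expR_gt0 // expRK lnV ?posrE // lerN2.
Qed.

Lemma half_exp : expR (- 1) <= 1 / 2 :> R.
Proof.
have := @expR_ge1Dx R 1; rewrite expRN div1r => h.
by rewrite lef_pV2 ?posrE ?expR_gt0 //; lra.
Qed.

Section Delta.
Variable delta : R.
Hypotheses (delta0 : 0 < delta) (delta1 : delta < 1).

Let ln_ge : 1 / 2 < ln (2 / delta).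
Proof.
apply: le_lt_trans ln2_ge _; rewrite ltr_ln ?posrE ?divr_gt0 //.
by rewrite ltr_pdivlMr //; move: delta0 delta1; lra.
Qed.

Lemma l_par_ge3 : (3 <= l_par delta)%N.
Proof.
rewrite -(ltr_nat R); apply: lt_le_trans (absz_ceil_ge _).
by have := ln_ge; lra.
Qed.

Lemma l_par_pow : (3 / 4) ^+ l_par delta <= delta / 2.
Proof.
have h : (3 / 4) ^+ l_par delta <= expR (- 1 / 4) ^+ l_par delta :> R.
  by rewrite lerXn2r ?nnegrE ?expR_ge0 ?(le_trans _ (expR_ge1Dx _)) //; lra.
apply: (le_trans h); rewrite -expRM_natl.
rewrite -[leRHS]lnK ?posrE ?divr_gt0 // ler_expR.
have -> : delta / 2 = (2 / delta)^-1 by rewrite invf_div.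
rewrite lnV ?posrE ?divr_gt0 //; clear h.
have := @absz_ceil_ge (4 * ln (2 / delta)); rewrite -/(l_par delta).
by move: ((l_par delta)%:R : R) (ln (2 / delta)) => u v; lra.
Qed.

Lemma lambda_par_ge0 : 0 <= lambda_par delta.
Proof. by rewrite le_min expR_ge0 andbT; lra. Qed.

Lemma lambda_par_le16 : lambda_par delta <= 1 / 16.
Proof. by rewrite ge_min lexx. Qed.

Lemma lambda_par_pow : lambda_par delta * 2 ^+ l_par delta <= 1.
Proof.
set l := l_par delta.
have ll : 1 <= ln (l%:R : R).
  apply: (le_trans ln3_ge1); have l3 := l_par_ge3; rewrite ler_ln ?posrE ?ltr0n ?ler_nat //.
  exact: leq_trans l3.
have : lambda_par delta <= (1 / 2) ^+ l.
  rewrite ge_min; apply/orP; right.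
  apply: (@le_trans _ _ (expR (- 1) ^+ l)); last first.
    by rewrite lerXn2r ?nnegrE ?expR_ge0 ?half_exp //; lra.
  rewrite -expRM_natl ler_expR mulrN1 lerN2 ler_peMr //.
  by rewrite exprn_ege1.
move=> h; apply: (le_trans (ler_wpM2r _ h)); first by rewrite exprn_ge0.
by rewrite -exprMn div1r mulVf ?expr1n.
Qed.

End Delta.

Section Eps.
Variable eps : R.
Hypotheses (eps0 : 0 < eps).

Lemma b_par_ge : 9 * 2 ^+ 23 <= eps ^+ 2 * (2 ^ lb_par eps)%:R.
Proof.
set X := 9 * 2 ^+ 23.
have X0 : 0 < X * eps ^- 2 by rewrite !mulr_gt0 ?exprn_gt0 // invr_gt0 exprn_gt0.
have ln20 : 0 < ln 2 :> R by have := ln2_ge; lra.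
rewrite mulrC -ler_pdivrMr ?exprn_gt0 //.
have h := absz_ceil_ge (ln (X * eps ^- 2) / ln 2); rewrite -/(lb_par eps) in h.
rewrite ler_pdivrMr // in h.
rewrite natrX -[leLHS]lnK ?posrE // -[leRHS]lnK ?posrE ?exprn_gt0 // ler_expR lnXn //.
by rewrite -[leRHS]mulr_natl.
Qed.

Lemma k_par_ge : (lb_par eps + 16 <= k_par eps)%N.
Proof.
rewrite -(ler_nat R); apply: le_trans (absz_ceil_ge _).
rewrite /b_par natrX lnXn // natrD lerD2r -[ln 2 *+ _]mulr_natl.
have := ln2_ge; have : 0 <= (lb_par eps)%:R :> R by [].
by move: (ln 2) (lb_par eps)%:R => u v; nra.
Qed.

End Eps.
End ParamBounds.

(* For D = 0 every transition weight is the junk value x / 0 = 0. *)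
Lemma walk_prob_degree0 {R : realType} {V : finType} (a : V -> V -> nat) L (E : pred (L.-tuple V)) :
  (2 <= L)%N -> walk_prob a 0 E = 0 :> R.
Proof.
move=> L2; rewrite /walk_prob big1 // => w _; rewrite /walk_weight.
case: w => -[|u [|v w]] /= sw; try by move/eqP: sw L2 => <-.
by rewrite big_cons /= invr0 mulr0 mul0r mulr0.
Qed.

Theorem theorem7 (R : realType) (n : nat) (eps delta : R)
  (df dg dh : nat) (Pf Pg Ph : {poly 'F_2}) (D : nat)
  (adj : Psi df dg dh (k_par eps) -> Psi df dg dh (k_par eps) -> nat)
  (A : {set 'I_n}) :
  (* standing parameters: n >= 1, 0 < eps < 1, (ln n)^-1 <= delta < 1
     (ln n > 0 is needed for (ln n)^-1 to make sense) *)
  (1 <= n)%N -> 0 < ln (n%:R : R) ->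
  0 < eps -> eps < 1 -> (ln (n%:R : R))^-1 <= delta -> delta < 1 ->
  (* G_2([n]) : GF(2^df), 2^df >= n *)
  irreducible_poly Pf -> size Pf = df.+1 -> (n <= 2 ^ df)%N ->
  (* H_2([n], [2^5 b^2]) : GF(2^dg), 2^dg >= n, dg >= log2(2^5 b^2) *)
  irreducible_poly Pg -> size Pg = dg.+1 -> (n <= 2 ^ dg)%N ->
  (5 + 2 * lb_par eps <= dg)%N ->
  (* H_k([2^5 b^2], [b]) : GF(2^dh), 2^dh >= 2^5 b^2, dh >= log2 b *)
  irreducible_poly Ph -> size Ph = dh.+1 ->
  (2 ^ 5 * b_par eps ^ 2 <= 2 ^ dh)%N -> (lb_par eps <= dh)%N ->
  (* G is a lambda-expander (D-regular) with vertex set Psi *)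
  expander adj D (lambda_par delta) ->
  A != finset.set0 ->
  walk_prob adj D (L := l_par delta)
    (fun w =>
       let q := q_of (lb_par eps) Pf Pg Ph A w in
       (`| estimate (tau2 (lb := lb_par eps) Pf Pg Ph A w q) q - (#|A|%:R)%:E |
          > (eps * #|A|%:R)%:E)%E)
  <= delta.
Proof.
move=> _ lnn eps0 eps1 hdelta delta1 irrf sizef nf irrg sizeg ng cg irrh sizeh bh _ expG.
rewrite -card_gt0 => A0.
have delta0 : 0 < delta by apply: lt_le_trans hdelta; rewrite invr_gt0.
have l3 := l_par_ge3 delta0 delta1.
set E := fun w => _.
case: (posnP D) => [D0|D0].
  by rewrite D0 walk_prob_degree0 ?ltW // (leq_trans _ l3).
set lb := lb_par eps.
have eps_b := b_par_ge eps0; rewrite -/lb in eps_b.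
have kge := k_par_ge eps; rewrite -/lb in kge.
have k6 : (6 <= k_par eps)%N by rewrite (leq_trans _ kge) // (leq_trans _ (leq_addl _ _)).
have lbk : (lb <= k_par eps)%N by rewrite (leq_trans _ kge) // leq_addr.
have ch : (5 + 2 * lb <= dh)%N.
  by move: bh; rewrite /b_par pow5E leq_exp2l.
pose qmax := (up_log 2 #|A| - lb)%N.
have Aq : (#|A| <= 2 ^ qmax * 2 ^ lb)%N.
  rewrite -expnD (@leq_trans (2 ^ up_log 2 #|A|)) ?up_logP //.
  by rewrite leq_exp2l // addnC -leq_subLR.
have V0 : (0 < #|{: Psi df dg dh (k_par eps)}|)%N.
  by rewrite !card_prod !muln_gt0 !card_ffun_ord_gt0.
have bad16 := bad_mean irrf sizef nf irrg sizeg ng irrh sizeh cg ch A0 eps0 eps1 eps_b k6 lbk.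
have tail := @row_bits_tail R n df dg dh (k_par eps) lb Pf Pg Ph A qmax irrf sizef nf Aq.
apply: le_trans (walk_tail D0 l3 (expn_gt0 2 lb) (lambda_par_ge0 delta) (lambda_par_le16 delta)
  (lambda_par_pow delta0 delta1) expG bad16 tail V0 _) _; last first.
  by have := l_par_pow delta0; rewrite ler_pdivlMr // mulrC.
move=> w Ew.
case: (leqP (l_par delta) (2 * count (fun psi => ~~ good lb Pf Pg Ph A eps psi) w)) => [|few]; first by left.
case: (ltnP (33 * 2 ^ lb * l_par delta)
  (\sum_(psi <- w) row_bits lb Pf Pg Ph A qmax psi)) => [|small]; first by right.
exfalso; move: Ew; rewrite /E /=; apply/negP; rewrite -leNgt.
set q := q_of _ _ _ _ _ _.
have qle : (q <= qmax)%N.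
  rewrite /q /q_of /qmin; case: ex_minnP => q' _; apply.
  rewrite /qP (leq_trans _ small) // big_tuple.
  by apply/eq_leq/eq_bigr => i _.
rewrite estimateE.
have sz : size [seq row_estimate (tau2 (lb := lb) Pf Pg Ph A w q i) q : \bar R
    | i <- enum 'I_(l_par delta)] = l_par delta by rewrite size_map size_enum_ord.
have := @median_between R [seq row_estimate (tau2 (lb := lb) Pf Pg Ph A w q i) q
    | i <- enum 'I_(l_par delta)]
  (#|A|%:R - eps * #|A|%:R)%:E (#|A|%:R + eps * #|A|%:R)%:E.
rewrite sz; set m := nth _ _ _ => H.
have {H} /andP[] : (((#|A|%:R - eps * #|A|%:R)%:E <= m) && (m <= (#|A|%:R + eps * #|A|%:R)%:E))%E.
  apply: H; apply: leq_ltn_trans few; rewrite leq_mul2l /=.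
  rewrite count_map -[X in (_ <= count _ X)%N](map_tnth_enum w) [leqRHS]count_map.
  apply: sub_count => i /=; apply: contraNN => gi.
  have qs : (q <= cutoff Pf A lb (tnth w i).1.1)%N.
    apply: (leq_trans qle); rewrite leq_subLR.
    case/and4P: gi => lf _ _ _.
    rewrite up_log_min // addnC expnD.
    by have := level_ok_cutoff lb lf; apply: leq_trans; rewrite leq_pmull.
  have [y -> ] := good_row_estimate sizef nf sizeg ng sizeh cg ch A0 eps0 eps1 eps_b k6 lbk gi qs.
  by rewrite !lee_fin -ler_distl.
case: m => [r| |] //; rewrite !lee_fin => h1 h2.
by rewrite ler_distl h1.
Qed.
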